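(* Let $(u_n)_{n\geq 1}$ be a sequence of elements of $\mathbb{S}^{d-1}$. Then $(u_n)_{n\geq 1}$ is $S$-universal if and only if it is $M$-universal.
   Context: Let $d$ be a positive integer, $\mathbb{S}^{d-1}$ the Euclidean unit sphere of $\mathbb{R}^d$, $D=B(0,1)$ the closed unit ball, and $\mathcal{K}_d$ the set of convex bodies of $\mathbb{R}^d$ (convex compact sets with nonempty interior), endowed with the Hausdorff distance $d_H$; all convergences of sets are for $d_H$. Steiner symmetrization: for $A\in\mathcal{K}_d$ and $u\in\mathbb{S}^{d-1}$, view $A$ as a family of line segments parallel to $u$; $S_uA$ is the set obtained by sliding each of these segments along $u$ so that its midpoint lies in the hyperplane $u^\perp$. Minkowski symmetrization: $B_uA=\frac12(A\oplus\pi_u(A))$, where $\pi_u$ is the orthogonal reflection with respect to the hyperplane $u^\perp$ and $\oplus$ is the Minkowski sum. The support function of $A$ is $f_A(\theta)=\sup_{x\in A}\langle x,\theta\rangle$ for $\theta\in\mathbb{S}^{d-1}$, and the mean radius of $A$ is $L(A)=\int_{\mathbb{S}^{d-1}}f_A\,d\sigma$, where $\sigma$ is the rotation-invariant (Haar) probability measure on $\mathbb{S}^{d-1}$. The number $r(A)>0$ is defined by the condition that the ball $r(A)D$ has the same volume as $A$. For $n\geq k\geq 1$ put $S_{k,n}A=S_{u_n}(\ldots S_{u_{k+1}}(S_{u_k}A)\ldots)$ and $B_{k,n}A=B_{u_n}(\ldots B_{u_{k+1}}(B_{u_k}A)\ldots)$. The sequence $(u_n)_{n\ge1}$ strongly $S$-rounds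 $A$ if for every $k\geq1$, $S_{k,n}A\to r(A)D$ as $n\to\infty$; it strongly $M$-rounds $A$ if for every $k\geq 1$, $B_{k,n}A\to L(A)D$ as $n\to\infty$. It is $S$-universal (respectively $M$-universal) if it strongly $S$-rounds (respectively strongly $M$-rounds) every $A\in\mathcal{K}_d$. *)

(* Defs.v *)
From HB Require Import structures.
From mathcomp Require Import all_boot all_order all_algebra.
From mathcomp Require Import all_classical all_reals all_analysis.
Set Implicit Arguments.
Unset Strict Implicit.
Unset Printing Implicit Defensive.
Import Order.TTheory GRing.Theory Num.Theory.
Import numFieldNormedType.Exports.
Local Open Scope classical_set_scope.
Local Open Scope ring_scope.

(* The library norm on ['rV[R]_d] is the sup norm; it induces the usual
   topology, but the metric notions below are all stated with [enorm]. *)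
Definition dotv (R : realType) (d : nat) (x y : 'rV[R]_d) : R :=
  \sum_(i < d) x 0 i * y 0 i.

Definition enorm (R : realType) (d : nat) (x : 'rV[R]_d) : R :=
  Num.sqrt (dotv x x).

Definition esphere (R : realType) (d : nat) : set 'rV[R]_d :=
  [set x | enorm x = 1].

Definition eball (R : realType) (d : nat) (r : R) : set 'rV[R]_d :=
  [set x | enorm x <= r].

Arguments esphere R d _ : clear implicits.
Arguments eball {R} d r _.

Definition convex_body (R : realType) (d : nat) (A : set 'rV[R]_d) : Prop :=
  [/\ convex_set (A : set (convex_lmodType 'rV[R]_d)), compact A
    & interior A !=set0].

Definition minkowski_sum (R : realType) (d : nat) (A B : set 'rV[R]_d) :
  set 'rV[R]_d := [set a + b | a in A & b in B].

(* The infimum is over a nonempty set when [A] and [B] are bounded and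
   nonempty. *)
Definition hausdorff_dist (R : realType) (d : nat) (A B : set 'rV[R]_d) : R :=
  inf [set e : R | [/\ 0 <= e, A `<=` minkowski_sum B (eball d e)
                             & B `<=` minkowski_sum A (eball d e)]].

Definition hausdorff_cvg (R : realType) (d : nat)
    (F : nat -> set 'rV[R]_d) (B : set 'rV[R]_d) : Prop :=
  (fun n => hausdorff_dist (F n) B) @ \oo --> (0 : R).

(* The [d]-fold product of the Lebesgue measure on [R], as an iterated
   integral of sections. *)
Fixpoint volume (R : realType) (d : nat) : set 'rV[R]_d -> \bar R :=
  match d return set 'rV[R]_d -> \bar R with
  | 0 => fun A => (\1_A 0)%:E
  | d'.+1 => fun A => (\int[@lebesgue_measure R]_t
      volume [set x : 'rV[R]_d' | A (row_mx (t%:M : 'rV[R]_1) x)])%E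
  end.

(* [`[a, b]] is the chord of [A] over the point [y] of the hyperplane
   orthogonal to [u]; it is slid so that the parameter [(a + b) / 2] of its
   midpoint becomes 0. *)
Definition steiner (R : realType) (d : nat) (u : 'rV[R]_d)
    (A : set 'rV[R]_d) : set 'rV[R]_d :=
  [set x | exists (y : 'rV[R]_d) (a b t : R),
    [/\ dotv y u = 0, [set s : R | A (y + s *: u)] = `[a, b]%classic,
        `[a, b]%classic t & x = y + (t - (a + b) / 2) *: u]].

(* Orthogonal reflection in the hyperplane orthogonal to a unit vector [u]. *)
Definition reflection (R : realType) (d : nat) (u x : 'rV[R]_d) : 'rV[R]_d :=
  x - (2 * dotv x u) *: u.

Definition minkowski_sym (R : realType) (d : nat) (u : 'rV[R]_d)
    (A : set 'rV[R]_d) : set 'rV[R]_d :=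
  [set 2^-1 *: x | x in minkowski_sum A (reflection u @` A)].

Definition support_fun (R : realType) (d : nat) (A : set 'rV[R]_d)
    (theta : 'rV[R]_d) : R := sup [set dotv x theta | x in A].

Notation borel_rV R d := (g_sigma_algebraType (@open 'rV[R]_d)).

(* The Haar probability measure on the unit sphere, seen as a Borel
   probability on the whole space that is carried by the sphere. Invariance is
   under the full orthogonal group: for [d = 1] the special orthogonal group
   is trivial and would not determine the measure. *)
Definition is_sphere_haar (R : realType) (d : nat)
    (sigma : probability (borel_rV R d) R) : Prop :=
  sigma (esphere R d) = 1%E /\
  forall Q : 'M[R]_d, Q *m Q^T = 1%:M ->
    forall B : set (borel_rV R d), measurable B ->
      sigma [set x : 'rV[R]_d | B (x *m Q)] = sigma B.

Definition mean_radius (R : realType) (d : nat)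
    (sigma : probability (borel_rV R d) R) (A : set 'rV[R]_d) : R :=
  \int[sigma]_(theta in esphere R d) support_fun A theta.

(* For a convex body the defining condition has exactly one solution. *)
Definition volume_radius (R : realType) (d : nat) (A : set 'rV[R]_d) : R :=
  get [set r : R | 0 < r /\ volume (eball d r) = volume A].

(* [iter_sym T u k n A = T (u n) (... (T (u k.+1) (T (u k) A)))]
   for [k <= n]. *)
Definition iter_sym (R : realType) (d : nat)
    (T : 'rV[R]_d -> set 'rV[R]_d -> set 'rV[R]_d)
    (u : nat -> 'rV[R]_d) (k n : nat) (A : set 'rV[R]_d) : set 'rV[R]_d :=
  foldl (fun B i => T (u i) B) A (index_iota k n.+1).

(* Sequences of directions are indexed from 1; [u 0] is never used. *)
Definition strongly_S_rounds (R : realType) (d : nat) (u : nat -> 'rV[R]_d)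
    (A : set 'rV[R]_d) : Prop :=
  forall k : nat, (1 <= k)%N ->
    hausdorff_cvg (fun n => iter_sym (@steiner R d) u k n A)
                  (eball d (volume_radius A)).

Definition strongly_M_rounds (R : realType) (d : nat)
    (sigma : probability (borel_rV R d) R) (u : nat -> 'rV[R]_d)
    (A : set 'rV[R]_d) : Prop :=
  forall k : nat, (1 <= k)%N ->
    hausdorff_cvg (fun n => iter_sym (@minkowski_sym R d) u k n A)
                  (eball d (mean_radius sigma A)).

Definition S_universal (R : realType) (d : nat) (u : nat -> 'rV[R]_d) : Prop :=
  forall A : set 'rV[R]_d, convex_body A -> strongly_S_rounds u A.

Definition M_universal (R : realType) (d : nat)
    (sigma : probability (borel_rV R d) R) (u : nat -> 'rV[R]_d) : Prop :=
  forall A : set 'rV[R]_d, convex_body A -> strongly_M_rounds sigma u A.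

(* Main.v *)
Require Import Defs.
From HB Require Import structures.
From mathcomp Require Import all_boot all_order all_algebra.
From mathcomp Require Import finmap.
From mathcomp Require Import all_classical all_reals all_analysis.
From mathcomp Require Import measurable_realfun.
From mathcomp Require Import ring lra zify.
Import numFieldNormedType.Exports.
Set Implicit Arguments.
Unset Strict Implicit.
Unset Printing Implicit Defensive.
Import Order.TTheory GRing.Theory Num.Theory.
Local Open Scope classical_set_scope.
Local Open Scope ring_scope.

(** The Steiner symmetral of a convex body is contained in its Minkowski
    symmetral in the same direction: a chord that is slid to a centred position
    consists of means of a point of the body and of the mirror image of another
    point of the same chord ([steinerE], [steiner_sub_minkowski_sym]). Moreover
    Steiner symmetrization keeps the volume ([volume_steiner]) and Minkowski
    symmetrization keeps the mean radius ([mean_radius_minkowski_sym]). By the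
    inclusion, Minkowski symmetrization cannot decrease the volume, and Steiner
    symmetrization cannot increase the mean radius.

    Suppose that the sequence is S-universal, and let [F n] be the Minkowski
    iterates of [A] from some index on. Their volume radii increase to a limit
    [rho]. For a fixed [m], the body [F n] contains the Steiner iterate of [F m]
    along the remaining directions, which tends to the ball with the volume of
    [F m]. So each ball of radius less than [rho] is eventually contained in
    [F n]. Since the volume of [F n] is at most that of the ball of radius [rho],
    convexity prevents [F n] from having points far out of this ball
    ([extra_ball], [eventually_sub_eball]). Hence [F n] tends to the ball of
    radius [rho], and [rho] is the mean radius of [A], which all the [F n] share.

    The converse is dual. If the sequence is M-universal, the mean radii of the
    Steiner iterates [F n] decrease to a limit [lam]; as [F n] is contained in
    the Minkowski iterate of [F m], it is eventually in each ball of radius more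
    than [lam]. Its mean radius is at least [lam], so its support function cannot
    be much smaller than [lam] at any point, since it would then be so on a
    spherical cap whose measure is bounded below ([support_ge_of_mean]). So
    [F n] tends to the ball of radius [lam], and the volumes identify [lam].

    In both directions, Hausdorff limits are handled through inclusions between
    concentric balls ([hausdorff_cvg_ballP], [hausdorff_cvg_ball]).

    The volume is an iterated integral, in which the coordinate axes play a
    special role, so its invariance under Steiner symmetrization in an arbitrary
    direction [u] needs an argument. If [u] is orthogonal to the first axis, it
    holds slice by slice, by induction on the dimension. Otherwise a shear along
    [u], which only translates the slices, makes [u] parallel to the first axis,
    and after an exchange of the integrals ([volume_shear]) the invariance is
    that of the lengths of chords. *)

(** * Euclidean inner product and norm *)

Section Euclid.
Variables (R : realType) (d : nat).
Implicit Types (x y z u v : 'rV[R]_d) (a r : R).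

Lemma dotvC x y : dotv x y = dotv y x.
Proof. by apply: eq_bigr => i _; rewrite mulrC. Qed.

Lemma dotvDl x y z : dotv (x + y) z = dotv x z + dotv y z.
Proof. by rewrite -big_split; apply: eq_bigr => i _; rewrite mxE mulrDl. Qed.

Lemma dotvZl a x y : dotv (a *: x) y = a * dotv x y.
Proof. by rewrite mulr_sumr; apply: eq_bigr => i _; rewrite mxE mulrA. Qed.

Lemma dotvNl x y : dotv (- x) y = - dotv x y.
Proof. by rewrite -scaleN1r dotvZl mulN1r. Qed.

Lemma dotvBl x y z : dotv (x - y) z = dotv x z - dotv y z.
Proof. by rewrite dotvDl dotvNl. Qed.

Lemma dotvDr x y z : dotv z (x + y) = dotv z x + dotv z y.
Proof. by rewrite !(dotvC z) dotvDl. Qed.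

Lemma dotvZr a x y : dotv x (a *: y) = a * dotv x y.
Proof. by rewrite !(dotvC x) dotvZl. Qed.

Lemma dotvNr x y : dotv x (- y) = - dotv x y.
Proof. by rewrite !(dotvC x) dotvNl. Qed.

Lemma dotvBr x y z : dotv z (x - y) = dotv z x - dotv z y.
Proof. by rewrite dotvDr dotvNr. Qed.

Lemma dotv0l x : dotv 0 x = 0.
Proof. by rewrite -(scale0r x) dotvZl mul0r. Qed.

Lemma dotvv_ge0 x : 0 <= dotv x x.
Proof. by apply: sumr_ge0 => i _; rewrite -expr2 sqr_ge0. Qed.

Lemma sqr_coord_le_dotv x i : x 0 i ^+ 2 <= dotv x x.
Proof.
rewrite /dotv (bigD1 i)//= -expr2 lerDl.
by apply: sumr_ge0 => j _; rewrite -expr2 sqr_ge0.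
Qed.

Lemma enorm_ge0 x : 0 <= enorm x. Proof. exact: sqrtr_ge0. Qed.

Lemma enorm_sqr x : enorm x ^+ 2 = dotv x x.
Proof. exact/sqr_sqrtr/dotvv_ge0. Qed.

Lemma enorm0 : enorm (0 : 'rV[R]_d) = 0.
Proof. by rewrite /enorm dotv0l sqrtr0. Qed.

Lemma enorm_eq0 x : enorm x = 0 -> x = 0.
Proof.
move=> x0; apply/rowP => i; rewrite mxE; apply/eqP.
rewrite -sqrf_eq0 eq_le sqr_ge0 andbT (le_trans (sqr_coord_le_dotv x i))//.
by rewrite -enorm_sqr x0 expr0n.
Qed.

Lemma enormZ a x : enorm (a *: x) = `|a| * enorm x.
Proof.
by rewrite /enorm dotvZl dotvZr mulrA -expr2 sqrtrM ?sqr_ge0// sqrtr_sqr.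
Qed.

Lemma enormN x : enorm (- x) = enorm x.
Proof. by rewrite -scaleN1r enormZ normrN1 mul1r. Qed.

Lemma le_enorm_dotv x r : 0 <= r -> (enorm x <= r) = (dotv x x <= r ^+ 2).
Proof. by move=> r0; rewrite -enorm_sqr ler_sqr// nnegrE ?enorm_ge0. Qed.

Lemma dotv_le_enorm x y : dotv x y <= enorm x * enorm y.
Proof.
have [x0|x0] := eqVneq (enorm x) 0.
  by rewrite x0 mul0r (enorm_eq0 x0) dotv0l.
have [y0|y0] := eqVneq (enorm y) 0.
  by rewrite y0 mulr0 (enorm_eq0 y0) dotvC dotv0l.
have xp : 0 < enorm x by rewrite lt_neqAle eq_sym x0 enorm_ge0.
have yp : 0 < enorm y by rewrite lt_neqAle eq_sym y0 enorm_ge0.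
have := dotvv_ge0 (enorm y *: x - enorm x *: y).
rewrite dotvBl !dotvBr !dotvZl !dotvZr -!enorm_sqr (dotvC y x).
have pp : 0 < enorm x * enorm y by rewrite mulr_gt0.
set p := enorm x; set q := enorm y; set t := dotv x y; rewrite -/p -/q in pp *.
rewrite [leRHS](_ : _ = (p * q) * (2 * (p * q - t))); last by ring.
by rewrite pmulr_rge0// pmulr_rge0// subr_ge0.
Qed.

Lemma enormD x y : enorm (x + y) <= enorm x + enorm y.
Proof.
rewrite le_enorm_dotv ?addr_ge0 ?enorm_ge0// dotvDl !dotvDr -!enorm_sqr.
rewrite (dotvC y x); have := dotv_le_enorm x y.
move: (enorm x) (enorm y) (dotv x y) => p q t h.
have -> : (p + q) ^+ 2 = p ^+ 2 + q ^+ 2 + 2 * (p * q) by ring.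
lra.
Qed.

Lemma enormB x y : enorm x - enorm y <= enorm (x - y).
Proof. by rewrite lerBlDr (le_trans _ (enormD _ _))// subrK. Qed.

Lemma enormC x y : enorm (x - y) = enorm (y - x).
Proof. by rewrite -enormN opprB. Qed.

Lemma coord_le_enorm x i : `|x 0 i| <= enorm x.
Proof. by rewrite -sqrtr_sqr ler_wsqrtr// sqr_coord_le_dotv. Qed.

Lemma normr_le_enorm x : `|x| <= enorm x.
Proof.
rewrite /Num.Def.normr/= mx_normrE; apply: bigmax_le => [|[i j] _ /=].
  exact: enorm_ge0.
by rewrite ord1 coord_le_enorm.
Qed.

Lemma coord_le_normr x i : `|x 0 i| <= `|x|.
Proof.
rewrite [leRHS]/Num.Def.normr/= mx_normrE.
by apply/bigmax_geP; right; exists (0, i).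
Qed.

Lemma enorm_le_normr x : enorm x <= d%:R * `|x|.
Proof.
have [->|d0] := eqVneq x 0; first by rewrite enorm0 mulr_ge0.
have dp : (0 < d)%N.
  rewrite lt0n; apply: contraNneq d0 => d0; apply/eqP/rowP => i.
  by have := ltn_ord i; rewrite {2}d0.
rewrite le_enorm_dotv ?mulr_ge0// (@le_trans _ _ (d%:R * `|x| ^+ 2))//.
  rewrite mulr_natl -[X in _ *+ X]card_ord -sumr_const; apply: ler_sum => i _.
  by rewrite -expr2 -[x 0 i ^+ 2]real_normK ?num_real// ler_sqr ?nnegrE// coord_le_normr.
by rewrite exprMn ler_wpM2r ?sqr_ge0// -natrX ler_nat -mulnn leq_pmulr.
Qed.
End Euclid.

(** * Compact convex sets and their symmetrals *)

Section ConvexCompact.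
Variables (R : realType) (d : nat).
Implicit Types (x y z u v : 'rV[R]_d) (a r t : R) (A B : set 'rV[R]_d).

(** Steiner symmetrization is applied to slices of convex bodies, which may have
    an empty interior, and this class is stable under slicing. *)
Definition convex_compact A : Prop :=
  (forall x y t, 0 <= t -> t <= 1 -> A x -> A y -> A (t *: x + (1 - t) *: y))
  /\ compact A.

Lemma convex_setE A : convex_set (A : set (convex_lmodType 'rV[R]_d)) <->
  (forall x y t, 0 <= t -> t <= 1 -> A x -> A y -> A (t *: x + (1 - t) *: y)).
Proof.
split=> [cA x y t t0 t1 Ax Ay|cA x y l].
  by have := cA x y (Itv01 t0 t1); rewrite !inE; exact.
by rewrite !inE => Ax Ay; apply: cA.
Qed.

Lemma convex_bodyE A : convex_body A <-> convex_compact A /\ interior A !=set0.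
Proof.
split=> [[/convex_setE cA kA iA]|[[cA kA] iA]]; first by [].
by split => //; apply/convex_setE.
Qed.

Lemma convex_body_convex_compact A : convex_body A -> convex_compact A.
Proof. by case/convex_bodyE. Qed.

Lemma dotv_continuous u : continuous (fun x => dotv x u).
Proof.
rewrite /dotv; apply: continuous_big => [|i _ x]; first exact: add_continuous.
 exact: cvgMr_tmp (@coord_continuous R 1 d 0 i x).
Qed.

Lemma enorm_continuous : continuous (@enorm R d).
Proof.
move=> x; apply: continuous_comp; last exact: sqrt_continuous.
move: x; apply: continuous_big => [|i _ x]; first exact: add_continuous.
exact: cvgM (@coord_continuous R 1 d 0 i x) (@coord_continuous R 1 d 0 i x).
Qed.

Lemma compact_enorm_bounded A : compact A ->
  exists2 M, 0 < M & forall x, A x -> enorm x <= M.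
Proof.
have [->|A0] := eqVneq A set0; first by move=> _; exists 1.
move=> cA; have [||c cA' cM] := @compact_EVT_max _ R (@enorm R d) A _ cA.
- exact/set0P.
- by apply: continuous_subspaceT; exact: enorm_continuous.
exists (enorm c + 1) => [|x Ax]; first by rewrite ltr_wpDl ?enorm_ge0.
by rewrite (le_trans (cM x _)) ?inE// lerDl.
Qed.

Lemma closed_enorm_bounded_compact A M : closed A ->
  (forall x, A x -> enorm x <= M) -> compact A.
Proof.
move=> clA AM; apply: bounded_closed_compact => //.
exists M; split; first exact: num_real.
move=> N /ltW MN x /AM xM; apply: le_trans (normr_le_enorm x) _.
exact: le_trans MN.
Qed.

Lemma closed_eball r : closed (eball d r : set 'rV[R]_d).
Proof.
rewrite (_ : eball d r = (@enorm R d) @^-1` [set y : R | y <= r])//.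
apply: preimage_closed => [x _|]; [exact: enorm_continuous|exact: closed_le].
Qed.

Lemma closed_esphere : closed (esphere R d).
Proof.
rewrite (_ : esphere R d = (@enorm R d) @^-1` [set y : R | y = 1])//.
apply: preimage_closed => [x _|]; [exact: enorm_continuous|exact: closed_eq].
Qed.

Lemma compact_esphere : compact (esphere R d).
Proof.
by apply: (@closed_enorm_bounded_compact _ 1) => [|x ->//]; exact: closed_esphere.
Qed.

Lemma convex_compact_eball r : convex_compact (eball d r : set 'rV[R]_d).
Proof.
split=> [x y t t0 t1 xr yr|].
  rewrite /eball/= (le_trans (enormD _ _))// !enormZ !ger0_norm ?subr_ge0//.
  rewrite (@le_trans _ _ (t * r + (1 - t) * r))//.
    by rewrite lerD// ler_wpM2l ?subr_ge0.
  by rewrite -mulrDl addrC subrK mul1r.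
by apply: (@closed_enorm_bounded_compact _ r) => //; exact: closed_eball.
Qed.

(** For a unit vector [u], the orthogonal projection onto its hyperplane. *)
Definition oproj u x := x - dotv x u *: u.

Lemma oprojB u x y : oproj u (x - y) = oproj u x - oproj u y.
Proof. by rewrite /oproj dotvBl scalerBl !opprD opprK addrACA. Qed.

Lemma oprojD u x y : oproj u (x + y) = oproj u x + oproj u y.
Proof. by rewrite /oproj dotvDl scalerDl !opprD addrACA. Qed.

Lemma oprojZ u a x : oproj u (a *: x) = a *: oproj u x.
Proof. by rewrite /oproj dotvZl scalerBr scalerA. Qed.

Lemma oproj_continuous u : continuous (oproj u).
Proof.
move=> x; exact: cvgB cvg_id (cvgZr_tmp (@dotv_continuous u x)).
Qed.

Lemma reflectionD u x y : reflection u (x + y) = reflection u x + reflection u y.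
Proof. by rewrite /reflection dotvDl mulrDr scalerDl opprD addrACA. Qed.

Lemma reflectionZ u a x : reflection u (a *: x) = a *: reflection u x.
Proof. by rewrite /reflection dotvZl scalerBr scalerA mulrCA. Qed.

Lemma reflection_continuous u : continuous (reflection u).
Proof.
move=> x; exact: cvgB cvg_id (cvgZr_tmp (cvgMl_tmp (@dotv_continuous u x))).
Qed.

Lemma dotv_reflection u x y : dotv (reflection u x) y = dotv x (reflection u y).
Proof.
by rewrite /reflection dotvBl dotvBr dotvZl dotvZr (dotvC u y) mulrAC.
Qed.

Section unit.
Variables (u : 'rV[R]_d) (u1 : enorm u = 1).

Lemma dotv_unit : dotv u u = 1. Proof. by rewrite -enorm_sqr u1 expr1n. Qed.

Lemma reflectionK : involutive (reflection u).
Proof.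
move=> x; rewrite {1}/reflection /reflection dotvBl dotvZl dotv_unit.
rewrite -addrA -opprD -scalerDl [X in X *: _](_ : _ = 0) ?scale0r ?subr0//.
by ring.
Qed.

Lemma enorm_reflection x : enorm (reflection u x) = enorm x.
Proof. by rewrite /enorm dotv_reflection reflectionK. Qed.

Lemma dotv_oproj x : dotv (oproj u x) u = 0.
Proof. by rewrite dotvBl dotvZl dotv_unit mulr1 subrr. Qed.
End unit.

(** Both symmetrals of [A] in the direction [u] are images by this map: of all
    the pairs of points of [A] for the Minkowski symmetral, of the pairs that
    lie on a common line parallel to [u] for the Steiner symmetral. *)
Definition sym_mean u (p : 'rV[R]_d * 'rV[R]_d) :=
  2^-1 *: (p.1 + reflection u p.2).

Lemma sym_mean_continuous u : continuous (sym_mean u).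
Proof.
have f1 : continuous (@fst 'rV[R]_d 'rV[R]_d) by move=> q; exact: cvg_fst.
have f2 : continuous (@snd 'rV[R]_d 'rV[R]_d) by move=> q; exact: cvg_snd.
move=> p; have h := continuous_comp (f2 p) (@reflection_continuous u _).
exact: cvgZl_tmp (cvgD (f1 p) h).
Qed.

Lemma enorm_sym_mean u p M : enorm u = 1 -> enorm p.1 <= M -> enorm p.2 <= M ->
  enorm (sym_mean u p) <= M.
Proof.
move=> u1 p1 p2; rewrite enormZ ger0_norm// ler_pdivrMl//.
by rewrite (le_trans (enormD _ _))// enorm_reflection//; lra.
Qed.

Lemma convex_compact_sym_mean u (C : set ('rV[R]_d * 'rV[R]_d)) :
  compact C ->
  (forall p q t, 0 <= t -> t <= 1 -> C p -> C q ->
    C (t *: p.1 + (1 - t) *: q.1, t *: p.2 + (1 - t) *: q.2)) ->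
  convex_compact (sym_mean u @` C).
Proof.
move=> cC vC; split=> [_ _ t t0 t1 [p Cp <-] [q Cq <-]|]; last first.
  by apply: continuous_compact => //; apply: continuous_subspaceT; exact: sym_mean_continuous.
exists (t *: p.1 + (1 - t) *: q.1, t *: p.2 + (1 - t) *: q.2); first exact: vC.
rewrite /sym_mean/= reflectionD !reflectionZ !scalerA.
rewrite (mulrC t) (mulrC (1 - t)) -!scalerA -scalerDr; congr (_ *: _).
by rewrite !scalerDr addrACA.
Qed.

Lemma minkowski_symE u A : minkowski_sym u A = sym_mean u @` (A `*` A).
Proof.
apply/seteqP; split=> [_ [_ [a Aa [_ [b Ab <-] <-]] <-]|_ [[a b] [/= Aa Ab] <-]].
  by exists (a, b).
exists (a + reflection u b) => //.
by exists a => //; exists (reflection u b) => //; exists b.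
Qed.

Lemma convex_compact_minkowski_sym u A : convex_compact A ->
  convex_compact (minkowski_sym u A).
Proof.
move=> [vA cA]; rewrite minkowski_symE; apply: convex_compact_sym_mean.
  exact: compact_setX.
by move=> p q t t0 t1 [Ap1 Ap2] [Aq1 Aq2]; split; apply: vA.
Qed.

Definition chord_pairs u A : set ('rV[R]_d * 'rV[R]_d) :=
  (A `*` A) `&` [set p | oproj u p.1 = oproj u p.2].

Definition on_line u y := [set x : 'rV[R]_d | oproj u x = y].

Lemma compact_line u y A : compact A -> compact (A `&` on_line u y).
Proof.
move=> cA; apply: compact_closedI => //.
apply: (@preimage_closed _ _ _ [set y]) => [x _|]; first exact: oproj_continuous.
exact/accessible_closed_set1/hausdorff_accessible/norm_hausdorff.
Qed.

(** The end points are the values of [dotv ^~ u] at its extrema on the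
    intersection of [A] and the line. *)
Lemma chordP u y A x : enorm u = 1 -> convex_compact A -> dotv y u = 0 ->
    A x -> oproj u x = y ->
  exists a b, [set s : R | A (y + s *: u)] = `[a, b]%classic.
Proof.
move=> u1 [vA cA] yu Ax xy.
have L0 : A `&` on_line u y !=set0 by exists x.
have cL := compact_line (u := u) (y := y) cA.
have dc : {within A `&` on_line u y, continuous (fun z => dotv z u)}.
  by apply: continuous_subspaceT; exact: dotv_continuous.
have lin z : oproj u z = y -> z = y + dotv z u *: u by move=> <-; rewrite subrK.
have dot s : dotv (y + s *: u) u = s.
  by rewrite dotvDl dotvZl dotv_unit// yu add0r mulr1.
have pr s : oproj u (y + s *: u) = y by rewrite /oproj dot addrK.
have [b /set_mem[Ab /lin bE] bM] := compact_EVT_max L0 cL dc.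
have [a /set_mem[Aa /lin aE] am] := compact_EVT_min L0 cL dc.
exists (dotv a u), (dotv b u); apply/seteqP; split=> [s /= As|s /=].
  rewrite in_itv/=; apply/andP; rewrite -[X in _ <= X /\ X <= _](dot s).
  by split; [apply: am|apply: bM]; rewrite inE; split => //; exact: pr.
rewrite in_itv/= => /andP[as_ sb].
have [ab|ab] := eqVneq (dotv a u) (dotv b u).
  have -> : s = dotv a u by apply/eqP; rewrite eq_le as_ ab sb.
  by rewrite -aE.
have ab' : 0 < dotv b u - dotv a u.
  by rewrite subr_gt0 lt_neqAle ab (le_trans as_).
set t := (s - dotv a u) / (dotv b u - dotv a u).
have -> : y + s *: u = t *: b + (1 - t) *: a.
  rewrite {1}bE {1}aE !scalerDr addrACA -scalerDl (addrC t) subrK scale1r.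
  rewrite !scalerA -scalerDl; congr (_ + _ *: _).
  by rewrite /t; field; rewrite gt_eqF.
apply: vA => //; first by rewrite /t divr_ge0 ?(ltW ab')// subr_ge0.
by rewrite /t ler_pdivrMr// mul1r lerD2r.
Qed.

(** Sliding the chord of [A] over [y] so as to centre it replaces it by the
   set of half differences of its points: both are the centred interval of the
   same length. Hence the symmetral is a continuous image of a compact set of
   pairs, and a subset of the Minkowski symmetral, which is the image of all
   the pairs by the same map. *)
Lemma steinerE u A : enorm u = 1 -> convex_compact A ->
  steiner u A = sym_mean u @` chord_pairs u A.
Proof.
move=> u1 cvA; apply/seteqP; split=> x.
  move=> [y [a [b [t [yu AE tab ->]]]]].
  have dot s : dotv (y + s *: u) u = s.
    by rewrite dotvDl dotvZl dotv_unit// yu add0r mulr1.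
  have tab' : `[a, b]%classic (a + b - t).
    by move: tab; rewrite /= !in_itv/= => /andP[? ?]; apply/andP; split; lra.
  exists (y + t *: u, y + (a + b - t) *: u).
    split; first by split; rewrite /= -[A _]/([set s | A (y + s *: u)] _) AE.
    by rewrite /= /oproj !dot !addrK.
  rewrite /sym_mean/= /reflection dot; apply/rowP => i; rewrite !mxE.
  by field.
move=> [[p q] [/= [Ap Aq] pq] <-].
set y := oproj u p.
have yu : dotv y u = 0 by exact: dotv_oproj.
have [a [b AE]] := chordP u1 cvA yu Ap erefl.
have pE : p = y + dotv p u *: u by rewrite subrK.
have qE : q = y + dotv q u *: u by rewrite /y pq subrK.
have : `[a, b]%classic (dotv p u) by rewrite -AE /= -pE.
have : `[a, b]%classic (dotv q u) by rewrite -AE /= -qE.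
rewrite /= !in_itv/= => /andP[aq qb] /andP[ap pb].
exists y, a, b, ((dotv p u - dotv q u) / 2 + (a + b) / 2); split=> //.
  by rewrite /= in_itv/=; apply/andP; split; lra.
rewrite /sym_mean/= /reflection {1}pE {1}qE; apply/rowP => i; rewrite !mxE.
by field.
Qed.

Lemma convex_compact_steiner u A : enorm u = 1 -> convex_compact A ->
  convex_compact (steiner u A).
Proof.
move=> u1 /[dup] cvA [vA cA]; rewrite steinerE//; apply: convex_compact_sym_mean.
  apply: compact_closedI; first exact: compact_setX.
  rewrite (_ : mkset _ = (fun p => oproj u (p.1 - p.2)) @^-1` [set 0]); last first.
    apply/seteqP; split=> p /=; first by rewrite oprojB => ->; rewrite subrr.
    by rewrite oprojB => /eqP; rewrite subr_eq0 => /eqP.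
  apply: preimage_closed => [p _|]; last first.
    exact/accessible_closed_set1/hausdorff_accessible/norm_hausdorff.
  have f1 : continuous (@fst 'rV[R]_d 'rV[R]_d) by move=> q; exact: cvg_fst.
  have f2 : continuous (@snd 'rV[R]_d 'rV[R]_d) by move=> q; exact: cvg_snd.
  exact: continuous_comp (cvgB (f1 p) (f2 p)) (@oproj_continuous u _).
move=> p q t t0 t1 [[Ap1 Ap2] pp] [[Aq1 Aq2] qq].
split; first by split; apply: vA.
by rewrite /= !oprojD !oprojZ pp qq.
Qed.

Lemma steiner_sub_minkowski_sym u A : enorm u = 1 -> convex_compact A ->
  steiner u A `<=` minkowski_sym u A.
Proof.
by move=> u1 cA; rewrite steinerE// minkowski_symE; apply: image_subset => p [].
Qed.

Lemma subset_minkowski_sym u A B : A `<=` B ->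
  minkowski_sym u A `<=` minkowski_sym u B.
Proof.
move=> AB; rewrite !minkowski_symE; apply: image_subset => p [? ?].
by split; apply: AB.
Qed.

End ConvexCompact.

(** * Convex bodies, support functions, Hausdorff limits *)

Section SupportHausdorff.
Variables (R : realType) (d : nat).
Implicit Types (x y z u v : 'rV[R]_d) (a r t e : R) (A B : set 'rV[R]_d).

Lemma enorm_interiorP A : interior A !=set0 <->
  exists c r, 0 < r /\ forall x, enorm (x - c) <= r -> A x.
Proof.
split=> [[c /nbhs_ballP[e /= e0 ceA]]|[c [r [r0 crA]]]].
  exists c, (e / 2); split=> [|x xc]; first by rewrite divr_gt0.
  apply: ceA; rewrite -ball_normE /ball_/= -normrN opprB.
  apply: le_lt_trans (normr_le_enorm _) _; apply: le_lt_trans xc _.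
  by rewrite gtr_pMr// invf_lt1// ltr1n.
(* The Euclidean norm is at most [d] times the sup norm; [d.+1] avoids a
   division by zero in dimension 0. *)
exists c; apply/nbhs_ballP; exists (r / d.+1%:R) => /=; first by rewrite divr_gt0.
move=> x; rewrite -ball_normE /ball_/= -normrN opprB => xc; apply: crA.
apply: le_trans (enorm_le_normr _) _.
apply: (@le_trans _ _ (d%:R * (r / d.+1%:R))).
  by rewrite ler_wpM2l// ltW.
by rewrite mulrCA ger_pMr// ler_pdivrMr// mul1r ler_nat.
Qed.

Lemma convex_body_nonempty A : convex_body A -> A !=set0.
Proof. by move=> [_ _ [c /interior_subset Ac]]; exists c. Qed.

(** For the interior: the symmetral of a ball with centre [c] is the ball of the same
    radius with centre [oproj u c]. *)
Lemma convex_body_steiner u A : enorm u = 1 -> convex_body A ->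
  convex_body (steiner u A).
Proof.
move=> u1 /convex_bodyE[cA /enorm_interiorP[c [r [r0 crA]]]].
apply/convex_bodyE; split; first exact: convex_compact_steiner.
apply/enorm_interiorP; exists (oproj u c), r; split=> // x xc.
rewrite steinerE//.
exists (x + dotv c u *: u, reflection u x + dotv c u *: u).
  split; [split; apply: crA => /=|].
  - rewrite (_ : _ - _ = x - oproj u c)//.
    by rewrite /oproj; apply/rowP => i; rewrite !mxE; ring.
  - rewrite (_ : _ - _ = reflection u (x - oproj u c)) ?enorm_reflection//.
    rewrite /reflection dotvBl dotv_oproj// subr0 /oproj.
    by apply/rowP => i; rewrite !mxE; ring.
  rewrite /= /oproj /reflection !(dotvDl, dotvNl, dotvZl) dotv_unit//.
  by apply/rowP => i; rewrite !mxE; ring.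
rewrite /sym_mean/= reflectionD reflectionK// reflectionZ /reflection dotv_unit//.
by apply/rowP => i; rewrite !mxE; field.
Qed.

Lemma convex_body_minkowski_sym u A : enorm u = 1 -> convex_body A ->
  convex_body (minkowski_sym u A).
Proof.
move=> u1 /[dup] bA /convex_body_convex_compact cA; apply/convex_bodyE.
split; first exact: convex_compact_minkowski_sym.
have [x Sx] : interior (steiner u A) !=set0 by have [] := convex_body_steiner u1 bA.
exists x; apply: interiorS Sx; exact: steiner_sub_minkowski_sym.
Qed.

Lemma subset_eball r e : r <= e -> eball d r `<=` eball d e.
Proof. by move=> re x /le_trans; apply. Qed.

Lemma minkowski_sym_sub_eball u A M : enorm u = 1 -> A `<=` eball d M ->
  minkowski_sym u A `<=` eball d M.
Proof.
move=> u1 AM; rewrite minkowski_symE => _ [p [/AM p1 /AM p2] <-].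
exact: enorm_sym_mean.
Qed.

Lemma support_attained A v : A !=set0 -> compact A ->
  exists2 x, A x & support_fun A v = dotv x v.
Proof.
move=> A0 cA; have [|c /set_mem Ac cM] := @compact_EVT_max _ R (fun x => dotv x v) A A0 cA.
  by apply: continuous_subspaceT; exact: dotv_continuous.
exists c => //; apply/eqP; rewrite eq_le; apply/andP; split.
  apply: ge_sup; first by exists (dotv c v), c.
  by move=> _ [x Ax <-]; apply: cM; rewrite inE.
apply: ub_le_sup; last by exists c.
by exists (dotv c v) => _ [x Ax <-]; apply: cM; rewrite inE.
Qed.

Lemma dotv_le_support A v x : compact A -> A x -> dotv x v <= support_fun A v.
Proof.
move=> cA Ax; apply: ub_le_sup; last by exists x.
have [M _ AM] := compact_enorm_bounded cA.
exists (M * enorm v) => _ [y Ay <-]; apply: le_trans (dotv_le_enorm _ _) _.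
by rewrite ler_wpM2r ?enorm_ge0// AM.
Qed.

Lemma support_le A v e : A !=set0 -> compact A ->
  (forall x, A x -> dotv x v <= e) -> support_fun A v <= e.
Proof. by move=> A0 cA Ae; have [x Ax ->] := support_attained v A0 cA; exact: Ae. Qed.

Lemma subset_support A B v : A !=set0 -> compact A -> compact B -> A `<=` B ->
  support_fun A v <= support_fun B v.
Proof.
by move=> A0 cA cB AB; apply: support_le => // x /AB; exact: dotv_le_support.
Qed.

Lemma support_le_eball A v M : A !=set0 -> compact A -> A `<=` eball d M ->
  support_fun A v <= M * enorm v.
Proof.
move=> A0 cA AM; apply: support_le => // x /AM xM.
apply: le_trans (dotv_le_enorm _ _) _.
by rewrite ler_wpM2r ?enorm_ge0.
Qed.

Lemma support_ge_eball A v r : compact A -> enorm v = 1 -> 0 <= r ->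
  eball d r `<=` A -> r <= support_fun A v.
Proof.
move=> cA v1 r0 rA; have -> : r = dotv (r *: v) v by rewrite dotvZl dotv_unit// mulr1.
by apply: dotv_le_support => //; apply: rA; rewrite /eball/= enormZ v1 mulr1 ger0_norm.
Qed.

Lemma support_lipschitz A v w M : A !=set0 -> compact A -> A `<=` eball d M ->
  support_fun A v - support_fun A w <= M * enorm (v - w).
Proof.
move=> A0 cA AM; have [x Ax ->] := support_attained v A0 cA.
have h := dotv_le_support w cA Ax.
apply: (@le_trans _ _ (dotv x (v - w))); first by rewrite dotvBr lerD2l lerN2.
apply: le_trans (dotv_le_enorm _ _) _.
by rewrite ler_wpM2r ?enorm_ge0//; exact: AM.
Qed.

(** Support functions turn Minkowski sums into sums, and reflections are
    self-adjoint. *)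
Lemma support_minkowski_sym u A v : A !=set0 -> compact A ->
  support_fun (minkowski_sym u A) v =
  2^-1 * (support_fun A v + support_fun A (reflection u v)).
Proof.
move=> A0 cA; have cB : compact (minkowski_sym u A).
  rewrite minkowski_symE; apply: continuous_compact; last exact: compact_setX.
  by apply: continuous_subspaceT; exact: sym_mean_continuous.
have dotE p : dotv (sym_mean u p) v =
    2^-1 * (dotv p.1 v + dotv p.2 (reflection u v)).
  by rewrite dotvZl dotvDl dotv_reflection.
have [x Ax xE] := support_attained v A0 cA.
have [y Ay yE] := support_attained (reflection u v) A0 cA.
apply/eqP; rewrite eq_le; apply/andP; split; last first.
  rewrite xE yE -(dotE (x, y)); apply: dotv_le_support => //.
  by rewrite minkowski_symE; exists (x, y).
apply: support_le => //; first by rewrite minkowski_symE; exists (sym_mean u (x, y)), (x, y).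
rewrite minkowski_symE => _ [p [p1 p2] <-]; rewrite dotE ler_wpM2l//.
by rewrite lerD// dotv_le_support.
Qed.

Lemma dotvv_subZ x y t : dotv (x - t *: y) (x - t *: y) =
  dotv x x - 2 * t * dotv y x + t ^+ 2 * dotv y y.
Proof.
by rewrite dotvBl !dotvBr !dotvZl !dotvZr (dotvC x y); ring.
Qed.

(** The variational inequality at the point [p] of [A] that is nearest to [x]. *)
Lemma nearest_pointP A x : A !=set0 -> convex_compact A ->
  exists p, A p /\ support_fun A (x - p) = dotv p (x - p).
Proof.
move=> A0 [vA cA].
have [|p /set_mem Ap pm] := @compact_EVT_min _ R (fun y => enorm (x - y)) A A0 cA.
  have f : continuous (fun z : 'rV[R]_d => x - z).
    by move=> z; apply: (@continuousB _ _ _ (cst x) id); [exact: cst_continuous|exact: cvg_id].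
  apply: continuous_subspaceT => y.
  exact: continuous_comp (f y) (@enorm_continuous R d _).
exists p; split=> //; apply/eqP; rewrite eq_le dotv_le_support// andbT.
apply: support_le => // y Ay.
set w := x - p; set z := y - p.
suff : dotv z w <= 0 by rewrite dotvBl subr_le0.
(* The distance to [x] does not decrease from [p] to the nearby points of the
   segment from [p] to [y]; the first order term gives the inequality. *)
have key t : 0 <= t -> t <= 1 -> 2 * t * dotv z w <= t ^+ 2 * dotv z z.
  move=> t0 t1; have := pm (t *: y + (1 - t) *: p); rewrite inE => /(_ (vA _ _ _ t0 t1 Ay Ap)).
  have -> : x - (t *: y + (1 - t) *: p) = w - t *: z.
    by apply/rowP => i; rewrite !mxE; ring.
  rewrite le_enorm_dotv ?enorm_ge0// -/w enorm_sqr dotvv_subZ.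
  lra.
rewrite leNgt; apply/negP => zw.
have zz : 0 < dotv z z.
  have := key 1 ler01 (lexx _); rewrite expr1n; lra.
pose t := Num.min 1 (dotv z w / dotv z z).
have t0 : 0 < t by rewrite lt_min ltr01 divr_gt0.
have t1 : t <= 1 by rewrite ge_min lexx.
have := key t (ltW t0) t1; rewrite expr2 -mulrA -mulrA mulrCA ler_pM2l//.
have : t * dotv z z <= dotv z w by rewrite -ler_pdivlMr// ge_min lexx orbT.
lra.
Qed.

(** At the nearest point [p] of [A] to [x], the direction of [x - p] has
    [dotv p v = support_fun A v], so the distance from [x] to [p] is at most
    [r] minus the value of the support function. *)
Lemma eball_sub_of_support A r e : A !=set0 -> convex_compact A ->
  (forall v, enorm v = 1 -> r - e <= support_fun A v) -> 0 <= e ->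
  eball d r `<=` minkowski_sum A (eball d e).
Proof.
move=> A0 cA Ar e0 x xr; have [p [Ap pE]] := nearest_pointP x A0 cA.
exists p => //; exists (x - p); last by rewrite addrC subrK.
rewrite /eball/=; have [->//|xp0] := eqVneq (enorm (x - p)) 0.
set n := enorm (x - p) in xp0 *.
have n0 : 0 < n by rewrite lt_neqAle eq_sym xp0 enorm_ge0.
pose v := n^-1 *: (x - p).
have v1 : enorm v = 1 by rewrite enormZ ger0_norm ?invr_ge0 ?ltW// -/n mulVf.
have vE : dotv p v = support_fun A v.
  apply/eqP; rewrite eq_le (dotv_le_support v cA.2 Ap)/=.
  apply: support_le => //; first exact: cA.2.
  move=> y Ay; rewrite !dotvZr ler_wpM2l ?invr_ge0 ?enorm_ge0// -pE.
  exact: dotv_le_support cA.2 Ay.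
have := Ar v v1; rewrite -vE.
have : dotv x v - dotv p v = n.
  rewrite -dotvBl dotvZr -enorm_sqr -/n expr2 mulKf//.
have : dotv x v <= r by rewrite (le_trans (dotv_le_enorm _ _))// v1 mulr1.
lra.
Qed.

Lemma minkowski_sum_eball0 A : minkowski_sum A (eball d 0) `<=` A.
Proof.
move=> _ [a Aa [b b0 <-]]; have -> : b = 0; last by rewrite addr0.
by apply: enorm_eq0; apply/eqP; rewrite eq_le enorm_ge0 andbT.
Qed.

(** The Minkowski sum with a ball of radius [e] adds at most [e] to the values of
    the support function on unit vectors. *)
Lemma eball_sub_of_minkowski A r e : A !=set0 -> convex_compact A -> 0 <= r ->
  eball d r `<=` minkowski_sum A (eball d e) -> eball d (r - e) `<=` A.
Proof.
move=> A0 cA r0 rA; apply: subset_trans (@minkowski_sum_eball0 A).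
apply: eball_sub_of_support => // v v1; rewrite subr0.
have [|a Aa [b be abE]] := rA (r *: v); first by rewrite /eball/= enormZ v1 mulr1 ger0_norm.
have : r = dotv a v + dotv b v.
  by rewrite -dotvDl abE dotvZl dotv_unit// mulr1.
have := dotv_le_support v cA.2 Aa.
have : dotv b v <= e by rewrite (le_trans (dotv_le_enorm _ _))// v1 mulr1.
lra.
Qed.

(** For compact convex sets, convergence to a ball can be tested by inclusions
    between concentric balls; [hausdorff_cvg_ball] is the converse. *)
Lemma hausdorff_cvg_ballP (F : nat -> set 'rV[R]_d) r :
  0 <= r -> (forall n, F n !=set0 /\ convex_compact (F n)) ->
  hausdorff_cvg F (eball d r) -> forall e, 0 < e ->
  \forall n \near \oo, F n `<=` eball d (r + e) /\ eball d (r - e) `<=` F n.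
Proof.
move=> r0 FP /cvgrPdist_lt Fr e e0; have := Fr e e0; apply: filterS => n.
rewrite sub0r normrN => /(le_lt_trans (ler_norm _)).
have [Fn0 cFn] := FP n; have [M M0 FM] := compact_enorm_bounded cFn.2.
rewrite /hausdorff_dist => /inf_lt-[|e' /= [e'0 Fe' eF'] e'e].
  exists (M + r); split.
  - by rewrite addr_ge0// ltW.
  - move=> x /FM xM; exists 0; first by rewrite /eball/= enorm0.
    by exists x; rewrite ?add0r// /eball/= (le_trans xM)// lerDl.
  - move=> x xr; have [p Fp] := Fn0; exists p => //; exists (x - p); last by rewrite addrC subrK.
    rewrite /eball/= (le_trans (enormD _ _))// enormN addrC lerD//; exact: FM.
split=> [x /Fe'[a ar [b be' <-]]|].
  by rewrite /eball/= (le_trans (enormD _ _))// lerD// (le_trans be')//; exact: ltW.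
have h := eball_sub_of_minkowski Fn0 cFn r0 eF'.
move=> x xr; apply: h; apply: subset_eball xr.
by rewrite lerD2l lerN2; exact: ltW.
Qed.

Lemma hausdorff_cvg_ball (F : nat -> set 'rV[R]_d) r :
  0 < r -> (forall n, F n !=set0 /\ convex_compact (F n)) ->
  (forall e, 0 < e -> e < r ->
    \forall n \near \oo, F n `<=` eball d (r + e) /\ eball d (r - e) `<=` F n) ->
  hausdorff_cvg F (eball d r).
Proof.
move=> r0 FP Fr; apply/cvgrPdist_le => e e0.
pose e' := Num.min e (r / 2).
have e'0 : 0 < e' by rewrite lt_min e0 divr_gt0.
have e'e : e' <= e by rewrite ge_min lexx.
have e'r : e' < r by rewrite gt_min gtr_pMr// invf_lt1// ltr1n orbT.
have := Fr e' e'0 e'r; apply: filterS => n [Fre reF].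
have [Fn0 cFn] := FP n.
rewrite sub0r normrN.
suff me : [/\ 0 <= e', F n `<=` minkowski_sum (eball d r) (eball d e')
    & eball d r `<=` minkowski_sum (F n) (eball d e')].
  rewrite ger0_norm; first by apply: le_trans e'e; apply: ge_inf => //; exists 0 => x [].
  by apply: lb_le_inf => [|x []//]; exists e'.
split; first exact: ltW.
- move=> x /Fre xr; have re0 : 0 < r + e' by rewrite addr_gt0.
  have h1 : 0 <= r / (r + e') by rewrite divr_ge0// ltW.
  have h2 : 0 <= e' / (r + e') by rewrite divr_ge0// ltW.
  exists ((r / (r + e')) *: x).
    rewrite /eball/= enormZ ger0_norm// -mulrA ger_pMr//.
    by rewrite ler_pdivrMl// mulr1.
  exists ((e' / (r + e')) *: x).
    rewrite /eball/= enormZ ger0_norm// -mulrA ger_pMr//.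
    by rewrite ler_pdivrMl// mulr1.
  by rewrite -scalerDl -mulrDl mulfV ?scale1r// gt_eqF.
- apply: eball_sub_of_support => //; last exact: ltW.
  move=> v v1; apply: support_ge_eball => //; first exact: cFn.2.
  by rewrite subr_ge0 ltW.
Qed.

End SupportHausdorff.

(** * Iterated symmetrizations *)

Section Iterate.
Variables (R : realType) (d : nat).
Implicit Types (T : 'rV[R]_d -> set 'rV[R]_d -> set 'rV[R]_d)
  (u : nat -> 'rV[R]_d) (A B : set 'rV[R]_d).

Lemma iter_sym_recr T u k n A : (k <= n.+1)%N ->
  iter_sym T u k n.+1 A = T (u n.+1) (iter_sym T u k n A).
Proof.
move=> kn; rewrite /iter_sym (_ : index_iota k n.+2 = rcons (index_iota k n.+1) n.+1).
  by rewrite foldl_rcons.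
by rewrite /index_iota subSn// -[(n.+1 - k).+1]addn1 iotaD subnKC// cats1.
Qed.

Lemma iter_sym_small T u k n A : (n < k)%N -> iter_sym T u k n A = A.
Proof. by move=> nk; rewrite /iter_sym /index_iota; move: nk; rewrite -subn_eq0 => /eqP ->. Qed.

Lemma iter_sym_cat T u k m n A : (k <= m.+1)%N -> (m <= n)%N ->
  iter_sym T u k n A = iter_sym T u m.+1 n (iter_sym T u k m A).
Proof.
move=> km mn; rewrite /iter_sym -foldl_cat; congr foldl.
rewrite /index_iota subSS (_ : n.+1 - k = (m.+1 - k) + (n - m))%N; last by lia.
by rewrite iotaD subnKC.
Qed.

Lemma iter_sym_ind T u (P : set 'rV[R]_d -> Prop) k n A : (1 <= k)%N ->
  (forall i B, (1 <= i)%N -> P B -> P (T (u i) B)) -> P A ->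
  P (iter_sym T u k n A).
Proof.
move=> k1 PT PA; elim: n => [|n IHn]; first by rewrite iter_sym_small.
have [kn|kn] := leqP k n.+1; last by rewrite iter_sym_small.
by rewrite iter_sym_recr//; apply: PT.
Qed.
End Iterate.

(** * Integrals of arbitrary nonnegative functions *)

(** The integral of a nonnegative function is the supremum of the integrals of
    the simple functions below it. Without measurability it is a lower
    integral, which is still monotone, homogeneous, superadditive and natural
    under changes of variables; so the iterated volume has the corresponding
    properties on arbitrary sets. *)
Section LowerIntegral.
Local Open Scope ereal_scope.
Context disp (T : measurableType disp) (R : realType)
  (mu : {measure set T -> \bar R}).
Implicit Types f g : T -> \bar R.

Import HBNNSimple.

Lemma ge0_le_lower_integral f g : (forall x, 0 <= f x) ->
  (forall x, f x <= g x) -> \int[mu]_x f x <= \int[mu]_x g x.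
Proof.
move=> f0 fg; rewrite !ge0_integralTE//; last by move=> x; exact: le_trans (fg x).
by apply: le_ereal_sup => _ [h hf <-]; exists h => // x; exact: le_trans (fg x).
Qed.

Lemma ereal_sup_addl_le (a c : \bar R) (B : set (\bar R)) : B !=set0 ->
  0 <= a -> (forall b, B b -> 0 <= b) -> (forall b, B b -> a + b <= c) ->
  a + ereal_sup B <= c.
Proof.
move=> [b0 Bb0] a0 B0 aBc; have := aBc _ Bb0; move: a0 aBc.
case: a => [a| |//] a0 aBc; last first.
  by rewrite addye ?leye_eq => [/eqP ->|]; rewrite ?leey// gt_eqF// (lt_le_trans _ (B0 _ Bb0)).
move=> _; rewrite addeC -leeBrDr//; apply: ge_ereal_sup => b Bb.
by rewrite leeBrDr// addeC aBc.
Qed.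

(** A sum of simple functions below [f] and below [g] is below their sum. *)
Lemma lower_integral_superadd f g : (forall x, 0 <= f x) -> (forall x, 0 <= g x) ->
  \int[mu]_x f x + \int[mu]_x g x <= \int[mu]_x (f x + g x).
Proof.
move=> f0 g0; rewrite !ge0_integralTE//; last by move=> x; rewrite adde_ge0.
set F := [set _ | _ in _]; set G := [set _ | _ in _ ].
have F0 : F !=set0 by exists (sintegral mu nnsfun0); exists nnsfun0.
have G0 : G !=set0 by exists (sintegral mu nnsfun0); exists nnsfun0.
have Fp a : F a -> 0 <= a by case=> h _ <-; exact: sintegral_ge0.
have Gp a : G a -> 0 <= a by case=> h _ <-; exact: sintegral_ge0.
apply: ereal_sup_addl_le => // [|_ [k kg <-]].
  by case: F0 => a Fa; apply: le_trans (Fp _ Fa) _; exact: ereal_sup_ubound.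
rewrite addeC; apply: ereal_sup_addl_le => // [|_ [h hf <-]]; first exact: sintegral_ge0.
rewrite addeC -sintegralD//; apply: ereal_sup_ubound.
by exists (add_nnsfun h k) => // x; rewrite /= EFinD leeD.
Qed.

(** Simple functions below [f] pull back to simple functions below [f \o phi].
    For an invertible [phi], the converse inequality follows by applying this
    to the inverse map. *)
Lemma lower_integral_comp_ge (phi : T -> T) (c : R) f :
  (0 < c)%R -> measurable_fun setT phi ->
  (forall B, measurable B -> mu (phi @^-1` B) = c%:E * mu B) ->
  (forall x, 0 <= f x) ->
  c%:E * \int[mu]_x f x <= \int[mu]_x f (phi x).
Proof.
move=> c0 mphi muphi f0; rewrite !ge0_integralTE// muleC -lee_pdivlMr//.
apply: ge_ereal_sup => _ [h hf <-]; rewrite lee_pdivlMr// muleC.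
pose g := h \o phi.
have mg : measurable_fun setT g by apply: measurableT_comp.
have fg : finite_set (range g).
  by apply: sub_finite_set (fimfunP h) => _ [x _ <-]; exists (phi x).
pose gm := isMeasurableFun.Build _ _ _ _ g mg.
pose gf := FiniteImage.Build _ _ g fg.
have g0 x : (0 <= g x)%R by exact: fun_ge0.
pose gn := isNonNegFun.Build _ _ g g0.
pose gh : {nnsfun T >-> R} := HB.pack g gm gf gn.
apply: ereal_sup_ubound; exists gh; first by move=> x; exact: hf.
rewrite /sintegral ge0_mule_fsumr; last exact: nnsfun_mulemu_ge0.
apply: eq_fsbigr => x _; rewrite muleCA -muphi//.
Qed.

Lemma lower_integralZl (c : R) f : (0 < c)%R -> (forall x, 0 <= f x) ->
  \int[mu]_x (c%:E * f x) = c%:E * \int[mu]_x f x.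
Proof.
have ge k g : (0 < k)%R -> (forall x, 0 <= g x) ->
    k%:E * \int[mu]_x g x <= \int[mu]_x (k%:E * g x).
  move=> k0 g0; have kg0 x : 0 <= k%:E * g x by rewrite mule_ge0// lee_fin ltW.
  rewrite !ge0_integralTE// muleC -lee_pdivlMr//.
  apply: ge_ereal_sup => _ [h hf <-]; rewrite lee_pdivlMr// muleC.
  rewrite -sintegralrM; apply: ereal_sup_ubound; exists (scale_nnsfun h (ltW k0)) => //.
  by move=> x /=; rewrite EFinM; apply: lee_wpmul2l => //; rewrite lee_fin ltW.
move=> c0 f0; apply/eqP; rewrite eq_le ge// andbT.
have cf0 x : 0 <= c%:E * f x by rewrite mule_ge0// lee_fin ltW.
rewrite -lee_pdivrMl//; apply: le_trans (ge _ _ _ cf0) _; rewrite ?invr_gt0//.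
by under eq_integral do rewrite muleA -EFinM mulVf ?gt_eqF// mul1e.
Qed.
End LowerIntegral.

Lemma ex_pushforward_measure d1 d2 (T1 : measurableType d1)
  (T2 : measurableType d2) (R : realType) (m : {measure set T1 -> \bar R})
  (f : T1 -> T2) (mf : measurable_fun setT f) :
  exists m' : {measure set T2 -> \bar R}, forall A, m' A = m (f @^-1` A).
Proof.
unshelve eexists; first by refine (pushforward m f : {measure set T2 -> \bar R}).
by [].
Qed.

Section AffineLebesgue.
Local Open Scope ereal_scope.
Variable R : realType.
Notation lambda := (@lebesgue_measure R).

Let aff (a s t : R) : R := ((t - a) / s)%R.

Lemma measurable_affine (a s : R) : measurable_fun [set: R] (aff a s).
Proof. by apply: measurable_funM => //; apply: measurable_funB. Qed.

(** The pushforward of the Lebesgue measure, divided by [s], gives the right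
    value to half-open intervals. *)
Lemma lebesgue_affine (a s : R) (B : set R) : (0 < s)%R -> measurable B ->
  lambda (aff a s @^-1` B) = s%:E * lambda B.
Proof.
move=> s0 mB; have ms := measurable_affine a s.
have si : (0 <= s^-1)%R by rewrite invr_ge0 ltW.
have [p pE] := @ex_pushforward_measure _ _ (measurableTypeR R) (measurableTypeR R)
  R lambda (aff a s) ms.
pose m : {measure set (measurableTypeR R) -> \bar R} := mscale (NngNum si) p.
have mE X : m X = s^-1%:E * lambda (aff a s @^-1` X) by rewrite -pE.
suff h : lambda B = m B.
  by rewrite h mE muleA -EFinM divff ?mul1e// gt_eqF.
apply: lebesgue_measure_unique => // _ [[x y] _ <-]; rewrite mE.
rewrite (_ : _ @^-1` _ = `](s * x + a)%R, (s * y + a)%R]%classic); last first.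
  apply/seteqP; split => t /=; rewrite !in_itv/= /aff ltr_pdivlMr// ler_pdivrMr//;
  by rewrite ltrBrDr lerBlDr !(mulrC s).
rewrite !lebesgue_measure_itv/= !lte_fin ltrD2r ltr_pM2l//.
case: ifPn => // _; last by rewrite mule0.
by rewrite -!EFinB -EFinM; congr (_%:E); field; rewrite gt_eqF.
Qed.

Lemma lower_integral_affine (a s : R) (f : R -> \bar R) : (0 < s)%R ->
  (forall t, 0 <= f t) ->
  \int[lambda]_t f (aff a s t) = s%:E * \int[lambda]_t f t.
Proof.
move=> s0 f0; apply/eqP; rewrite eq_le; apply/andP; split; last first.
  apply: lower_integral_comp_ge => //; first exact: measurable_affine.
  by move=> B mB; exact: lebesgue_affine.
have si : (0 < s^-1)%R by rewrite invr_gt0.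
have := @lower_integral_comp_ge _ _ R lambda (aff (- a / s) s^-1) s^-1
  (f \o aff a s) si (measurable_affine _ _)
  (fun B mB => lebesgue_affine _ si mB) (fun t => f0 _).
rewrite lee_pdivrMl// => /le_trans; apply; apply: lee_wpmul2l; first by rewrite lee_fin ltW.
rewrite le_eqVlt; apply/orP; left; apply/eqP; apply: eq_integral => t _ /=.
by congr f; rewrite /aff; field; rewrite gt_eqF.
Qed.
End AffineLebesgue.

(** * The iterated volume of arbitrary sets *)

Section Volume.
Variable R : realType.
Notation lambda := (@lebesgue_measure R).
Implicit Types d : nat.

Definition cons_coord d (t : R) (x : 'rV[R]_d) : 'rV[R]_d.+1 :=
  row_mx (t%:M : 'rV[R]_1) x.

Definition tail_coord d (x : 'rV[R]_d.+1) : 'rV[R]_d := \row_i x 0 (lift 0 i).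

Definition slice d (A : set 'rV[R]_d.+1) (t : R) : set 'rV[R]_d :=
  [set x | A (cons_coord t x)].

Lemma cons_coord0 d t (x : 'rV[R]_d) : cons_coord t x 0 0 = t.
Proof.
rewrite (_ : 0 = @lshift 1 d 0 :> 'I_d.+1); last exact: val_inj.
apply: etrans (row_mxEl (t%:M : 'rV_1) x 0 0) _.
by rewrite mxE eqxx.
Qed.

Lemma cons_coordS d t (x : 'rV[R]_d) i : cons_coord t x 0 (lift 0 i) = x 0 i.
Proof.
rewrite (_ : lift 0 i = rshift 1 i :> 'I_d.+1); last exact: val_inj.
exact: row_mxEr (t%:M : 'rV_1) x 0 i.
Qed.

Lemma rV_consP d (x y : 'rV[R]_d.+1) :
  x 0 0 = y 0 0 -> (forall i, x 0 (lift 0 i) = y 0 (lift 0 i)) -> x = y.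
Proof.
by move=> e0 eS; apply/rowP => i; case: (unliftP 0 i) => [j ->|->].
Qed.

Lemma cons_coordK d t (x : 'rV[R]_d) : tail_coord (cons_coord t x) = x.
Proof. by apply/rowP => i; rewrite mxE cons_coordS. Qed.

Lemma cons_coord_eta d (x : 'rV[R]_d.+1) : cons_coord (x 0 0) (tail_coord x) = x.
Proof. by apply: rV_consP => [|i]; rewrite ?cons_coord0 ?cons_coordS ?mxE. Qed.

Lemma cons_coordD d a b (x y : 'rV[R]_d) :
  cons_coord (a + b) (x + y) = cons_coord a x + cons_coord b y.
Proof. by apply: rV_consP => [|i]; rewrite [RHS]mxE ?cons_coord0// !cons_coordS mxE. Qed.

Lemma cons_coordZ d a b (x : 'rV[R]_d) :
  cons_coord (a * b) (a *: x) = a *: cons_coord b x.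
Proof. by apply: rV_consP => [|i]; rewrite [RHS]mxE ?cons_coord0// !cons_coordS mxE. Qed.

Lemma volumeS d (A : set 'rV[R]_d.+1) :
  volume A = (\int[lambda]_t volume (slice A t))%E.
Proof. by []. Qed.

Lemma volume_ge0 d (A : set 'rV[R]_d) : (0 <= volume A)%E.
Proof.
elim: d A => [|d IHd] A /=; first by rewrite lee_fin.
by apply: integral_ge0 => t _; exact: IHd.
Qed.

Lemma volume_le d (A B : set 'rV[R]_d) : A `<=` B -> (volume A <= volume B)%E.
Proof.
elim: d A B => [|d IHd] A B AB.
  rewrite /= lee_fin !indicE ler_nat; case: (boolP (0 \in A)) => //.
  by rewrite inE => /AB B0; rewrite mem_set.
apply: ge0_le_lower_integral => [t|t]; first exact: volume_ge0.
by apply: IHd => x; exact: AB.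
Qed.

Lemma volume_superadd d (A B : set 'rV[R]_d) : A `&` B = set0 ->
  (volume A + volume B <= volume (A `|` B))%E.
Proof.
elim: d A B => [|d IHd] A B AB.
  rewrite /= -EFinD lee_fin !indicE -natrD ler_nat in_setU.
  have : 0 \notin A `&` B by rewrite AB in_set0.
  by rewrite in_setI; case: (_ \in A); case: (_ \in B).
rewrite !volumeS; apply: le_trans (lower_integral_superadd _ _ _) _.
- by move=> t; exact: volume_ge0.
- by move=> t; exact: volume_ge0.
apply: ge0_le_lower_integral => [t|t]; first by rewrite adde_ge0// volume_ge0.
apply: IHd; apply/seteqP; split => // x [Ax Bx].
by have : (A `&` B) (cons_coord t x) by []; rewrite AB.
Qed.

Lemma volume_affine d (A : set 'rV[R]_d) (v : 'rV[R]_d) (s : R) : 0 < s ->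
  volume [set x | A (s^-1 *: (x - v))] = ((s ^+ d)%:E * volume A)%E.
Proof.
move=> s0; elim: d A v => [|d IHd] A v.
  rewrite expr0 mul1e /= !indicE; congr ((nat_of_bool _)%:R%:E).
  by apply/idP/idP; rewrite !inE/= [_ *: _]thinmx0.
rewrite volumeS.
have e t x : s^-1 *: (cons_coord t x - v) =
    cons_coord ((t - v 0 0) / s) (s^-1 *: (x - tail_coord v)).
  rewrite [in RHS]mulrC cons_coordZ cons_coordD; congr (_ *: (_ + _)).
  have -> : - v 0 0 = -1 * v 0 0 by rewrite mulN1r.
  have -> : - tail_coord v = -1 *: tail_coord v by rewrite scaleN1r.
  by rewrite cons_coordZ cons_coord_eta scaleN1r.
have E t : slice [set x | A (s^-1 *: (x - v))] t =
    [set x | slice A ((t - v 0 0) / s) (s^-1 *: (x - tail_coord v))].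
  by apply/seteqP; split=> x; rewrite /slice/= e.
under eq_integral do rewrite E IHd.
rewrite lower_integralZl ?exprn_gt0//; last by move=> t; exact: volume_ge0.
rewrite (lower_integral_affine (v 0 0) s0 (f := fun t => volume (slice A t))).
  by rewrite muleA -EFinM exprSr.
by move=> t; exact: volume_ge0.
Qed.

Lemma volume_set0 d : volume (set0 : set 'rV[R]_d) = 0%E.
Proof.
elim: d => [|d IHd]; first by rewrite /= indicE in_set0.
by apply: integral0_eq => t _; exact: IHd.
Qed.

(** Cubes have a product structure, so their volumes can be computed; they show
    that the volumes of balls are positive and finite. *)
Definition cube d (c : R) : set 'rV[R]_d := [set x | forall i, `|x 0 i| <= c].
Arguments cube d c _ : clear implicits.

Lemma volume_cube d (c : R) : 0 <= c -> volume (cube d c) = ((2 * c) ^+ d)%:E.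
Proof.
move=> c0; elim: d => [|d IHd].
  by rewrite /= indicE mem_set// => -[].
rewrite volumeS.
have E t : volume (slice (cube d.+1 c) t) =
    (((2 * c) ^+ d)%:E * (\1_(`[- c, c]%classic) t)%:E)%E.
  rewrite indicE; case: (boolP (t \in _)) => tc.
    rewrite mulr1n mule1 -IHd; congr volume.
    move: tc; rewrite inE/= in_itv/= -ler_norml => tc.
    apply/seteqP; split=> x /= xc i.
      by have := xc (lift 0 i); rewrite cons_coordS.
    by case: (unliftP 0 i) => [j ->|->]; rewrite ?cons_coordS ?cons_coord0.
  rewrite mulr0n mule0 -(@volume_set0 d); congr volume.
  apply/seteqP; split=> // x /= xc; move: tc => /negP; apply.
  by rewrite inE/= in_itv/= -ler_norml -(cons_coord0 t x).
under eq_integral do rewrite E.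
rewrite ge0_integralZl_EFin//; last 2 first.
- by apply/measurable_EFinP; exact: measurable_indic.
- by rewrite exprn_ge0// mulr_ge0.
rewrite integral_indic//= setIT lebesgue_measure_itv/=.
rewrite lte_fin; case: ifPn => [_|cc].
  by rewrite -EFinB -EFinM exprSr; congr (_ * _)%:E; ring.
have -> : c = 0.
  apply/eqP; rewrite eq_le c0 andbT leNgt; apply: contra cc => cp.
  by rewrite (lt_trans _ cp)// oppr_lt0.
by rewrite mule0 mulr0 expr0n.
Qed.

Lemma eball_sub_cube d (r : R) : eball d r `<=` cube d r.
Proof. by move=> x xr i; apply: le_trans xr; exact: coord_le_enorm. Qed.

Lemma cube_sub_eball d (r : R) : 0 <= r -> cube d (r / d.+1%:R) `<=` eball d r.
Proof.
move=> r0 x xr; rewrite /eball/=; apply: le_trans (enorm_le_normr x) _.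
have : `|x| <= r / d.+1%:R.
  rewrite /Num.Def.normr/= mx_normrE; apply: bigmax_le => [|[i j] _ /=].
    by rewrite divr_ge0.
  by rewrite ord1; exact: xr.
move=> h; apply: (@le_trans _ _ (d%:R * (r / d.+1%:R))); first by rewrite ler_wpM2l.
rewrite mulrCA ler_piMr// ler_pdivrMr// mul1r ler_nat.
by [].
Qed.

Lemma volume_eball_fin d (r : R) : 0 < r ->
  (0 < volume (eball d r))%E /\ (volume (eball d r) < +oo)%E.
Proof.
move=> r0; split.
  apply: lt_le_trans (volume_le (cube_sub_eball (ltW r0))).
  by rewrite volume_cube ?lte_fin ?exprn_gt0 ?mulr_gt0 ?divr_gt0// ltW// divr_gt0.
apply: le_lt_trans (volume_le (@eball_sub_cube d r)) _.
by rewrite volume_cube ?ltry// ltW.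
Qed.

Definition unit_ball_volume d : R := fine (volume (eball d (1 : R))).

Lemma unit_ball_volume_gt0 d : 0 < unit_ball_volume d.
Proof.
by have [? ?] := @volume_eball_fin d 1 ltr01; rewrite fine_gt0//; apply/andP.
Qed.

Lemma volume_eball_at d (c : 'rV[R]_d) (r : R) : 0 < r ->
  volume [set x | enorm (x - c) <= r] = (r ^+ d * unit_ball_volume d)%:E.
Proof.
move=> r0; have [v0 voo] := @volume_eball_fin d 1 ltr01.
rewrite EFinM /unit_ball_volume fineK; last by rewrite ge0_fin_numE// volume_ge0.
rewrite -(volume_affine _ c r0); congr volume; apply/seteqP; split=> x /=;
  rewrite /eball/= enormZ ger0_norm ?invr_ge0 ?(ltW r0)//;
  by rewrite ler_pdivrMl// mulr1.
Qed.

Lemma volume_eball d (r : R) : 0 < r ->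
  volume (eball d r) = (r ^+ d * unit_ball_volume d)%:E.
Proof.
move=> r0; rewrite -(volume_eball_at 0 r0); congr volume.
by apply/seteqP; split=> x; rewrite /eball/= subr0.
Qed.

Lemma convex_body_volume d (A : set 'rV[R]_d) : convex_body A ->
  exists2 v, 0 < v & volume A = v%:E.
Proof.
move=> /convex_bodyE[[_ cA] /enorm_interiorP[c [r [r0 crA]]]].
have [M M0 AM] := compact_enorm_bounded cA.
have Al : ((r ^+ d * unit_ball_volume d)%:E <= volume A)%E.
  by rewrite -(volume_eball_at c r0); exact: volume_le.
have Au : (volume A <= (M ^+ d * unit_ball_volume d)%:E)%E.
  by rewrite -volume_eball//; exact: volume_le.
have Af : volume A \is a fin_num.
  by rewrite ge0_fin_numE ?volume_ge0// (le_lt_trans Au)// ltry.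
exists (fine (volume A)); last by rewrite fineK.
rewrite -lte_fin fineK// (lt_le_trans _ Al)// lte_fin.
by rewrite mulr_gt0 ?unit_ball_volume_gt0// exprn_gt0.
Qed.

Lemma volume_eball_le d (r s : R) : (0 < d)%N -> 0 < r -> 0 < s ->
  (volume (eball d r) <= volume (eball d s))%E = (r <= s).
Proof.
move=> d0 r0 s0; rewrite !volume_eball// lee_fin ler_pM2r ?unit_ball_volume_gt0//.
by rewrite ler_pXn2r// nnegrE ltW.
Qed.

(** The volume of a ball of radius [r] is [r ^+ d] times that of the unit ball,
    so the radius is a [d]-th root. *)
Lemma volume_radiusP d (A : set 'rV[R]_d) : (0 < d)%N -> convex_body A ->
  0 < volume_radius A /\ volume (eball d (volume_radius A)) = volume A.
Proof.
move=> d0 /convex_body_volume[v v0 Av].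
suff h : [set r : R | 0 < r /\ volume (eball d r) = volume A] !=set0 by exact: (getPex h).
have w0 : 0 < v / unit_ball_volume d by rewrite divr_gt0 ?unit_ball_volume_gt0.
exists ((v / unit_ball_volume d) `^ (d%:R^-1)) => /=.
split; first exact: powR_gt0.
rewrite volume_eball ?powR_gt0// Av -powR_mulrn ?powR_ge0// -powRrM.
rewrite mulVf ?pnatr_eq0 ?gtn_eqF// powRr1 ?ltW//.
by rewrite divfK// gt_eqF// unit_ball_volume_gt0.
Qed.

End Volume.

(** * A measure that agrees with the volume *)

Section SigmaFiniteMeasure.
Context disp (T : measurableType disp) (R : realType)
  (m : {measure set T -> \bar R}) (sf : sigma_finite setT m).

(** A name for [m] to which the structure of sigma-finite measure is attached. *)
Definition sigma_finite_copy : set T -> \bar R := m.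
HB.instance Definition _ := Measure.on sigma_finite_copy.
HB.instance Definition _ := Measure_isSigmaFinite.Build _ _ _ sigma_finite_copy sf.

Lemma ex_sigma_finite_measure :
  exists M : {sigma_finite_measure set T -> \bar R}, forall A, M A = m A.
Proof. by exists sigma_finite_copy. Qed.
End SigmaFiniteMeasure.

Section VolumeMeasure.
Variable R : realType.
Notation lambda := (@lebesgue_measure R).

(** The sigma-algebra of row vectors is generated by the coordinates rather than
    by the open sets, because it is then obvious that adding a coordinate is a
    measurable operation from the product space. *)
Definition coord_cylinders d : set (set 'rV[R]_d) :=
  [set A | exists (i : 'I_d) (B : set (measurableTypeR R)),
    measurable B /\ A = [set x : 'rV[R]_d | B (x 0 i)]].

Notation cyl_rV d := (g_sigma_algebraType (@coord_cylinders d)).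

Lemma measurable_coord d (i : 'I_d) :
  measurable_fun [set: cyl_rV d] (fun x : cyl_rV d => x 0 i : measurableTypeR R).
Proof.
by move=> _ B mB; rewrite setTI; apply: sub_sigma_algebra; exists i, B.
Qed.

Lemma measurable_fun_cyl d disp (T : measurableType disp) (f : T -> cyl_rV d) :
  (forall i, measurable_fun setT (fun x => f x 0 i : measurableTypeR R)) ->
  measurable_fun setT f.
Proof.
move=> mf; apply: (@measurability _ _ T (cyl_rV d) setT f (@coord_cylinders d)) => //.
move=> _ [_ [i [B [mB ->]]] <-]; rewrite setTI.
by have := mf i measurableT B mB; rewrite setTI.
Qed.

(** A compact set is the intersection over [n] of finite unions of boxes of size
    [1 / n.+1] centred at its points, and boxes are finite intersections of
    cylinders. *)
Lemma compact_cyl_measurable d (K : set 'rV[R]_d) : compact K ->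
  measurable (K : set (cyl_rV d)).
Proof.
move=> cK; have clK : closed K := compact_closed (@norm_hausdorff _ _) cK.
have mball (c : 'rV[R]_d) (e : R) : measurable (ball c e : set (cyl_rV d)).
  have [e0|e0] := ltP 0 e; last first.
    rewrite (_ : ball c e = set0) ?measurable0//; apply/seteqP; split=> // x [e1 _].
    by move: e0; rewrite leNgt e1.
  rewrite (_ : ball c e = \bigcap_(i in [set: 'I_d])
      [set x : cyl_rV d | ball (c 0 i) e (x 0 i)]).
    apply: fin_bigcap_measurable => // i _.
    have := @measurable_coord d i measurableT (ball (c 0 i) e) (measurable_ball _ _).
    by rewrite setTI.
  apply/seteqP; split=> x; first by move=> [_ cx] i _; exact: cx.
  by move=> cx; split => // i j; rewrite ord1; exact: cx.
have cov n : exists D : set 'rV[R]_d, finite_set D /\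
    K `<=` cover D (fun c => ball c n.+1%:R^-1) /\ D `<=` K.
  move: cK; rewrite compact_cover => /(_ _ K (fun c => ball c n.+1%:R^-1))[].
  - by move=> c _; apply: ball_open; rewrite invr_gt0.
  - by move=> x Kx; exists x => //; apply: ballxx; rewrite invr_gt0.
  - move=> D DK KD; exists [set` D]; split; first exact: finite_fset.
    by split=> // x /DK /set_mem.
pose D n := projT1 (cid (cov n)).
have [Dfin [KD DK]] : (forall n, finite_set (D n)) /\
    (forall n, K `<=` cover (D n) (fun c => ball c n.+1%:R^-1)) /\
    (forall n, D n `<=` K).
  by split=> [n|]; [|split=> n]; rewrite /D; case: cid => ? /= [? []].
rewrite (_ : K = \bigcap_n cover (D n) (fun c => ball c n.+1%:R^-1)).
  apply: bigcapT_measurable => n; apply: fin_bigcup_measurable => //.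
apply/seteqP; split=> [x Kx n _|x Kx]; first exact: KD.
rewrite closure_id in clK; rewrite clK => B /nbhs_ballP[e /= e0 eB].
have [n ne] : exists n, n.+1%:R^-1 < e.
  have [n ne] := ltr_add_invr e0; exists n.
  by rewrite add0r in ne.
have [c /= cD cx] := Kx n I; exists c; split; first exact: DK cD.
by apply: eB; apply: le_ball (ltW ne) _ _; apply: ball_sym.
Qed.

(** By induction, the measure is the image of the product of the Lebesgue
    measure with the measure in dimension [d], whose value is by definition the
    integral of the measures of slices. *)
Lemma ex_volume_measure d : exists m : {sigma_finite_measure set (cyl_rV d) -> \bar R},
  forall A, measurable A -> m A = volume (A : set 'rV[R]_d).
Proof.
elim: d => [|d [m mE]].
  by exists (\d_(0 : cyl_rV 0)) => A mA; rewrite /= diracE indicE.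
pose f (p : measurableTypeR R * cyl_rV d) : cyl_rV d.+1 := cons_coord p.1 p.2.
have mf : measurable_fun setT f.
  apply: measurable_fun_cyl => i; rewrite /f; case: (unliftP 0 i) => [j ->|->].
    under eq_fun do rewrite cons_coordS.
    exact: measurableT_comp (measurable_coord j) measurable_snd.
  under eq_fun do rewrite cons_coord0; exact: measurable_fst.
have [m' m'E] := ex_pushforward_measure (lambda \x m)%E mf.
have {}m'E A : measurable A -> m' A = volume (A : set 'rV[R]_d.+1).
  move=> mA; rewrite m'E volumeS; apply: eq_integral => t _ /=.
  have sE : xsection (f @^-1` A) t = slice A t.
    by apply/seteqP; split=> x; [move/set_mem|move=> h; apply/mem_set].
  rewrite sE; apply: mE; rewrite -sE; apply: measurable_xsection.
  by have := mf measurableT _ mA; rewrite setTI.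
have sf : sigma_finite setT m'.
  exists (fun n => eball d.+1 (n.+1%:R : R)).
    apply/seteqP; split=> // x _.
    by exists (Num.truncn (enorm x)) => //; rewrite /eball/= ltW// truncnS_gt.
  move=> n; have mn : measurable (eball d.+1 (n.+1%:R : R) : set (cyl_rV d.+1)).
    by apply: compact_cyl_measurable; exact: (@convex_compact_eball R d.+1 n.+1%:R).2.
  by split=> //; rewrite m'E//; have [] := @volume_eball_fin R d.+1 n.+1%:R (ltr0Sn _ _).
have [M ME] := ex_sigma_finite_measure sf.
by exists M => A mA; rewrite ME m'E.
Qed.

End VolumeMeasure.

(** * Steiner symmetrization preserves the volume *)

Section SteinerVolume.
Variable R : realType.
Notation lambda := (@lebesgue_measure R).
Notation cyl_rV d := (g_sigma_algebraType (@coord_cylinders R d)).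

Lemma dotv_cons d (x y : 'rV[R]_d.+1) :
  dotv x y = x 0 0 * y 0 0 + dotv (tail_coord x) (tail_coord y).
Proof.
by rewrite /dotv big_ord_recl; congr (_ + _); apply: eq_bigr => i _; rewrite !mxE.
Qed.

Lemma tail_coord_continuous d : continuous (@tail_coord R d).
Proof.
move=> x B /nbhs_ballP[e /= e0 eB]; apply/nbhs_ballP; exists e => //= y [_ xy].
by apply: eB; split=> // i j; rewrite !mxE; exact: xy.
Qed.

(** Slices are compact as images by [tail_coord] of intersections with a
    hyperplane. *)
Lemma convex_compact_slice d (A : set 'rV[R]_d.+1) t : convex_compact A ->
  convex_compact (slice A t).
Proof.
move=> [vA cA]; split=> [x y k k0 k1 Ax Ay|].
  rewrite /slice/= (_ : cons_coord _ _ =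
    k *: cons_coord t x + (1 - k) *: cons_coord t y); first exact: vA.
  by rewrite -!cons_coordZ -cons_coordD -mulrDl (addrC k) subrK mul1r.
rewrite (_ : slice A t = @tail_coord R d @` (A `&` [set x | x 0 0 = t])).
  apply: continuous_compact; first exact/continuous_subspaceT/tail_coord_continuous.
  apply: compact_closedI => //.
  apply: (@preimage_closed _ _ _ [set y : R | y = t]) => [x _|]; last exact: closed_eq.
  exact: coord_continuous.
apply/seteqP; split=> [x Ax|_ [x [Ax xt] <-]].
  exists (cons_coord t x); last exact: cons_coordK.
  by split => //; rewrite /= cons_coord0.
by rewrite /slice/= -xt cons_coord_eta.
Qed.

Section chord.
Variables (d : nat) (u : 'rV[R]_d) (A : set 'rV[R]_d).
Hypotheses (u1 : enorm u = 1) (cA : convex_compact A).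

Lemma chord_steiner_iff y s : dotv y u = 0 ->
  steiner u A (y + s *: u) <->
  exists s1 s2, [/\ A (y + s1 *: u), A (y + s2 *: u) & s = (s1 - s2) / 2].
Proof.
move=> yu; have dot k : dotv (y + k *: u) u = k.
  by rewrite dotvDl dotvZl dotv_unit// yu add0r mulr1.
rewrite steinerE//; split=> [[[p q] [[/= Ap Aq] pq] E]|[s1 [s2 [A1 A2 ->]]]].
  have E1 : oproj u p = y.
    have := congr1 (oproj u) E; rewrite {2}/oproj dot addrK => <-.
    rewrite /sym_mean/= oprojZ oprojD /reflection.
    rewrite [oproj u (q - _)](_ : _ = oproj u q); last first.
      rewrite /oproj !(dotvDl, dotvNl, dotvZl) dotv_unit//.
      by apply/rowP => i; rewrite !mxE; ring.
    rewrite -(pq : oproj u p = oproj u q).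
    by move: (oproj u p) => z; apply/rowP => i; rewrite !mxE; field.
  exists (dotv p u), (dotv q u); split.
  - by rewrite -E1 subrK.
  - by rewrite -E1 pq subrK.
  have := congr1 (fun x => dotv x u) E; rewrite dot => <-.
  rewrite /sym_mean/= dotvZl dotvDl dotv_reflection /reflection.
  by rewrite dotvBr dotvZr !dotv_unit//; field.
exists (y + s1 *: u, y + s2 *: u).
  by split => //=; rewrite /oproj !dot !addrK.
rewrite /sym_mean/= /reflection dot.
by apply/rowP => i; rewrite !mxE; field.
Qed.

(** Both chords are intervals of the same length, or both are empty. *)
Lemma lebesgue_chord_steiner y : dotv y u = 0 ->
  [/\ measurable [set s : R | A (y + s *: u)],
    measurable [set s : R | steiner u A (y + s *: u)] &
    lambda [set s | steiner u A (y + s *: u)] = lambda [set s | A (y + s *: u)]].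
Proof.
move=> yu; have [AE|/set0P[s0 As0]] := eqVneq [set s : R | A (y + s *: u)] set0.
  have -> : [set s : R | steiner u A (y + s *: u)] = set0.
    apply/seteqP; split=> // s /= /(chord_steiner_iff _ yu)[s1 [s2 [A1 _ _]]].
    by have : [set s : R | A (y + s *: u)] s1 by []; rewrite AE.
  by rewrite AE.
have py : oproj u (y + s0 *: u) = y.
  by rewrite /oproj dotvDl dotvZl dotv_unit// yu add0r mulr1 addrK.
have [a [b AE]] := chordP u1 cA yu As0 py.
have Aab s : A (y + s *: u) <-> a <= s <= b.
  by rewrite -[A _]/([set s : R | A (y + s *: u)] s) AE /= in_itv.
have SE : [set s : R | steiner u A (y + s *: u)] = `[(a - b) / 2, (b - a) / 2]%classic.
  apply/seteqP; split=> s /=; rewrite in_itv/=.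
    move=> /(chord_steiner_iff _ yu)[s1 [s2 [/Aab/andP[? ?] /Aab/andP[? ?] ->]]].
    by apply/andP; split; lra.
  move=> /andP[? ?]; apply/(chord_steiner_iff _ yu).
  exists ((a + b) / 2 + s), ((a + b) / 2 - s); split; last by field.
    by apply/Aab/andP; split; lra.
  by apply/Aab/andP; split; lra.
rewrite AE SE; split=> //; rewrite !lebesgue_measure_itv/= !lte_fin.
have -> : ((a - b) / 2 < (b - a) / 2) = (a < b) by apply/idP/idP; lra.
by case: ifPn => // _; rewrite -!EFinB; congr (_%:E); field.
Qed.

Lemma lebesgue_line_steiner (p : 'rV[R]_d) (a : R) : 0 < a ->
  lambda [set t | steiner u A (p + (t / a) *: u)] =
  lambda [set t | A (p + (t / a) *: u)].
Proof.
move=> a0; have yu : dotv (oproj u p) u = 0 by exact: dotv_oproj.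
have [mA mS E] := lebesgue_chord_steiner yu.
have aff (B : set 'rV[R]_d) : [set t | B (p + (t / a) *: u)] =
    (fun t => (t - - (a * dotv p u)) / a) @^-1` [set s | B (oproj u p + s *: u)].
  apply/seteqP; split=> t; rewrite /preimage/=;
  rewrite (_ : oproj u p + _ *: u = p + (t / a) *: u)//;
  by rewrite /oproj; apply/rowP => i; rewrite !mxE; field; rewrite gt_eqF.
by rewrite !aff !lebesgue_affine// E.
Qed.
End chord.

Lemma steinerN d (u : 'rV[R]_d) (A : set 'rV[R]_d) : enorm u = 1 ->
  convex_compact A -> steiner (- u) A = steiner u A.
Proof.
move=> u1 cA; have pN x : oproj (- u) x = oproj u x.
  by rewrite /oproj dotvNr scalerN scaleNr opprK.
have rN x : reflection (- u) x = reflection u x.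
  by rewrite /reflection dotvNr mulrN scalerN scaleNr opprK.
rewrite !steinerE ?enormN//; apply/seteqP; split=> _ [p [Ap pp] <-]; exists p => //.
- by split=> //; move: pp; rewrite /= !pN.
- by rewrite /sym_mean rN.
- by split=> //; rewrite /= !pN.
- by rewrite /sym_mean rN.
Qed.

(** The volume as an integral over the direction [u]: the slices are sheared
    along [u], which does not change their volumes, and then the order of
    integration is exchanged. *)
Lemma volume_shear d (u : 'rV[R]_d.+1) (A : set 'rV[R]_d.+1)
    (m : {sigma_finite_measure set (cyl_rV d) -> \bar R}) :
  (forall B, measurable B -> m B = volume (B : set 'rV[R]_d)) ->
  0 < u 0 0 -> compact A ->
  volume A = (\int[m]_z lambda [set t | A (cons_coord 0 z + (t / u 0 0) *: u)%R])%E.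
Proof.
move=> mE u0 cA; set a := u 0 0; set w := a^-1 *: tail_coord u.
pose f (p : measurableTypeR R * cyl_rV d) : cyl_rV d.+1 :=
  cons_coord p.1 ((p.2 : 'rV[R]_d) + p.1 *: w).
have mf : measurable_fun setT f.
  apply: measurable_fun_cyl => i; rewrite /f; case: (unliftP 0 i) => [j ->|->].
    under eq_fun do rewrite cons_coordS mxE [X in _ + X]mxE.
    apply: measurable_funD.
      exact: measurableT_comp (measurable_coord j) measurable_snd.
    exact: measurable_funM measurable_fst _.
  under eq_fun do rewrite cons_coord0; exact: measurable_fst.
have mA : measurable (f @^-1` A).
  by have := mf measurableT _ (compact_cyl_measurable cA); rewrite setTI.
have fE t z : f (t, z) = cons_coord 0 (z : 'rV[R]_d) + (t / a) *: u.
  rewrite /f/= -{1}(cons_coord_eta u) -cons_coordZ -cons_coordD add0r.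
  by rewrite divfK ?gt_eqF// /w scalerA.
rewrite volumeS.
transitivity (\int[lambda]_t (m \o xsection (f @^-1` A)) t)%E.
  apply: eq_integral => t _ /=.
  rewrite mE; last exact: measurable_xsection.
  have := volume_affine (slice A t) (- (t *: w)) (@ltr01 R).
  rewrite expr1n mul1e => <-; congr volume.
  apply/seteqP; split=> z /=; rewrite invr1 scale1r opprK.
    by move=> h; apply/mem_set.
  by move=> /set_mem.
have := @indic_fubini_tonelli _ _ _ _ R lambda m _ mA.
rewrite indic_fubini_tonelli_FE// indic_fubini_tonelli_GE// => ->.
apply: eq_integral => z _ /=; congr (lambda _).
apply/seteqP; split=> t /=; first by move/set_mem; rewrite /preimage/= fE.
by move=> h; apply/mem_set; rewrite /preimage/= fE.
Qed.

(** If [u] has a nonzero first coordinate, [volume_shear] writes the volume as an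
    integral of lengths of chords parallel to [u], and symmetrization keeps the
    length of each chord. Otherwise [u] is parallel to the slices, the slices of
    the symmetral are the symmetrals of the slices, and the induction hypothesis
    applies. *)
Lemma volume_steiner d (u : 'rV[R]_d) (A : set 'rV[R]_d) : enorm u = 1 ->
  convex_compact A -> volume (steiner u A) = volume A.
Proof.
elim: d u A => [|d IHd] u A u1 cA.
  by move: u1; rewrite (thinmx0 u) enorm0 => /esym/eqP; rewrite oner_eq0.
wlog u0 : u u1 / 0 <= u 0 0.
  move=> wl; have [/wl->//|u0] := leP 0 (u 0 0).
  by rewrite -steinerN// wl ?enormN// mxE oppr_ge0 ltW.
have cS := convex_compact_steiner u1 cA.
move: u0; rewrite le_eqVlt => /predU1P[/esym u0|u0]; last first.
  have [m mE] := ex_volume_measure R d.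
  rewrite !(volume_shear mE u0)//; [|exact: cA.2|exact: cS.2].
  by apply: eq_integral => z _; exact: lebesgue_line_steiner.
have u1' : enorm (tail_coord u) = 1.
  by rewrite -u1 /enorm dotv_cons u0 mul0r add0r.
rewrite !volumeS; apply: eq_integral => t _.
rewrite -(IHd _ _ u1' (convex_compact_slice _ cA)); congr volume.
have uE s : s *: u = cons_coord 0 (s *: tail_coord u).
  by rewrite -(mulr0 s) cons_coordZ -u0 cons_coord_eta.
have lineE y s : cons_coord t y + s *: u = cons_coord t (y + s *: tail_coord u).
  by rewrite uE -cons_coordD addr0.
apply/seteqP; split=> x.
  move=> [y [a [b [k [yu AE kab xE]]]]].
  have yt : y = cons_coord t (tail_coord y).
    rewrite -{1}(cons_coord_eta y); congr cons_coord.
    by have := congr1 (fun z : 'rV[R]_d.+1 => z 0 0) xE; rewrite cons_coord0 !mxE u0 mulr0 addr0.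
  exists (tail_coord y), a, b, k; split=> //.
  - by move: yu; rewrite dotv_cons u0 mulr0 add0r.
  - by rewrite -AE; apply/seteqP; split=> s; rewrite /slice/= -lineE -yt.
  - by rewrite -(cons_coordK t x) xE {1}yt lineE cons_coordK.
move=> [y [a [b [k [yu AE kab xE]]]]]; exists (cons_coord t y), a, b, k; split=> //.
- by rewrite dotv_cons u0 mulr0 add0r cons_coordK.
- by rewrite -AE; apply/seteqP; split=> s; rewrite /slice/= lineE.
- by rewrite xE lineE.
Qed.
End SteinerVolume.

(** * The mean radius *)

Section MeanRadius.
Variables (R : realType) (d : nat) (sigma : probability (borel_rV R d) R).
Hypothesis haar : is_sphere_haar sigma.
Implicit Types (u v : 'rV[R]_d) (A B : set 'rV[R]_d) (f g : 'rV[R]_d -> R).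
Local Notation S := (esphere R d : set (borel_rV R d)).

Lemma open_borel A : open A -> measurable (A : set (borel_rV R d)).
Proof. exact: sub_sigma_algebra. Qed.

Lemma closed_borel A : closed A -> measurable (A : set (borel_rV R d)).
Proof.
by move=> /closed_openC/open_borel/measurableC; rewrite setCK.
Qed.

Lemma continuous_borel f : continuous f ->
  measurable_fun [set: borel_rV R d] (f : borel_rV R d -> measurableTypeR R).
Proof.
move=> /continuousP cf; apply: (measurability _ (RGenOpens.measurableE R)).
move=> _ [_ [a [b ->]] <-]; rewrite setTI; apply: open_borel; apply: cf.
exact: interval_open.
Qed.

Lemma continuous_borel_rV (f : 'rV[R]_d -> 'rV[R]_d) : continuous f ->
  measurable_fun [set: borel_rV R d] (f : borel_rV R d -> borel_rV R d).
Proof.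
move=> /continuousP cf.
apply: (@measurability _ _ (borel_rV R d) (borel_rV R d) setT f
  (@open 'rV[R]_d)) => //.
by move=> _ [U oU <-]; rewrite setTI; apply: open_borel; exact: cf.
Qed.

Lemma measurable_sphere : measurable S.
Proof. exact: closed_borel (@closed_esphere R d). Qed.

Lemma continuous_integrable f : continuous f -> sigma.-integrable S (EFin \o f).
Proof.
move=> cf; apply: measurable_bounded_integrable.
- exact: measurable_sphere.
- by rewrite (le_lt_trans (probability_le1 _ measurable_sphere))// ltry.
- by apply: measurable_funTS; exact: continuous_borel.
have /compact_bounded[M [Mr fM]] : compact (f @` esphere R d).
  apply: continuous_compact; last exact: compact_esphere.
  exact: continuous_subspaceT.
by exists M; split => // N MN x Sx; apply: fM MN _ _; exists x.
Qed.

Lemma mean_cst (r : R) : \int[sigma]_(x in S) r = r.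
Proof.
rewrite Rintegral_cst; last exact: measurable_sphere.
rewrite -[RHS]mulr1; congr (r * _).
transitivity (fine (1%E : \bar R)) => //; congr fine; exact: haar.1.
Qed.

Lemma mean_le f g : continuous f -> continuous g ->
  (forall v, enorm v = 1 -> f v <= g v) ->
  \int[sigma]_(x in S) f x <= \int[sigma]_(x in S) g x.
Proof.
move=> cf cg fg; apply: le_Rintegral; [exact: measurable_sphere|
  exact: continuous_integrable|exact: continuous_integrable|exact: fg].
Qed.

Lemma mulmxr_continuous (Q : 'M[R]_d) : continuous (fun x : 'rV[R]_d => x *m Q).
Proof.
move=> x B /nbhs_ballP[e /= e0 eB].
have fx : Filter (nbhs x) by exact: nbhs_filter.
have h i : \forall y \near x, ball ((x *m Q) 0 i) e ((y *m Q) 0 i).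
  have dE (y : 'rV[R]_d) : (y *m Q) 0 i = dotv y (col i Q)^T.
    by rewrite mxE; apply: eq_bigr => j _; rewrite !mxE.
  have := @cvg_ball _ _ _ (nbhs x) fx _ _ (@dotv_continuous R d (col i Q)^T x) e e0.
  by apply: (@filterS _ (nbhs x) fx) => y; rewrite !dE.
have hh := @filter_forall _ _ _ (nbhs x) fx h.
apply: (@filterS _ (nbhs x) fx) hh => y xy; apply: eB.
by split=> // i j; rewrite ord1; exact: xy.
Qed.

Lemma mean_orthogonal f (Q : 'M[R]_d) : Q *m Q^T = 1%:M -> continuous f ->
  \int[sigma]_(x in S) f (x *m Q) = \int[sigma]_(x in S) f x.
Proof.
move=> QQ cf.
have cQ : continuous (fun x : 'rV[R]_d => x *m Q).
  exact: mulmxr_continuous.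
pose phi : borel_rV R d -> borel_rV R d := fun x => (x : 'rV[R]_d) *m Q.
have mQ : measurable_fun setT phi := continuous_borel_rV cQ.
have SQ : phi @^-1` S = S.
  have dQ (x : 'rV[R]_d) : enorm (x *m Q) = enorm x.
    rewrite /enorm; congr Num.sqrt.
    have dE (y : 'rV[R]_d) : dotv y y = (y *m y^T) 0 0.
      by rewrite mxE; apply: eq_bigr => i _; rewrite mxE.
    by rewrite !dE trmx_mul mulmxA -(mulmxA x) QQ mulmx1.
  by apply/seteqP; split=> x; rewrite /preimage/= /esphere/= dQ.
rewrite /Rintegral; congr fine.
have := @integral_pushforward _ _ _ _ R _ mQ sigma S (EFin \o f).
move=> /(_ _ _ measurable_sphere) h.
transitivity (\int[pushforward sigma phi]_(y in S) (f y)%:E)%E.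
  rewrite h ?SQ//; first by apply/measurable_EFinP; exact: continuous_borel.
  apply: (@continuous_integrable (f \o (fun x => x *m Q))).
  by move=> x; apply: continuous_comp; [exact: cQ|exact: cf].
apply: eq_measure_integral => A mA _.
exact: haar.2.
Qed.

Lemma reflection_mx u : enorm u = 1 ->
  exists2 Q : 'M[R]_d, Q *m Q^T = 1%:M & forall x, reflection u x = x *m Q.
Proof.
move=> u1; pose Q : 'M[R]_d := 1%:M - 2 *: (u^T *m u).
have QE x : reflection u x = x *m Q.
  rewrite /Q mulmxBr mulmx1 -scalemxAr mulmxA; congr (_ - _).
  rewrite (_ : x *m u^T = (dotv x u)%:M) ?mul_scalar_mx ?scalerA//.
  apply/matrixP => i j; rewrite !ord1 !mxE eqxx mulr1n.
  by apply: eq_bigr => k _; rewrite mxE.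
exists Q => //; have -> : Q^T = Q.
  by rewrite /Q linearB/= linearZ/= trmx1 trmx_mul trmxK.
apply/row_matrixP => i; rewrite !rowE mulmxA -!QE reflectionK// mulmx1//.
Qed.

Lemma support_continuous A : A !=set0 -> compact A -> continuous (support_fun A).
Proof.
move=> A0 cA v B /nbhs_ballP[e /= e0 eB].
have [M M0 AM] := compact_enorm_bounded cA.
have k0 : 0 < M * d.+1%:R by rewrite mulr_gt0.
apply/nbhs_ballP; exists (e / (M * d.+1%:R)) => /=; first by rewrite divr_gt0.
move=> w; rewrite -ball_normE /ball_/= ltr_pdivlMr// => vw; apply: eB.
have h : M * enorm (v - w) < e.
  apply: le_lt_trans vw; rewrite mulrCA ler_wpM2l ?(ltW M0)//.
  apply: le_trans (enorm_le_normr _) _.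
  by rewrite [leRHS]mulrC ler_wpM2r// ler_nat.
rewrite -ball_normE /ball_/=; apply: le_lt_trans h; rewrite ler_norml.
rewrite (support_lipschitz _ _ A0 cA AM) andbT lerNl opprB enormC.
exact: support_lipschitz _ _ A0 cA AM.
Qed.

Lemma mean_radius_minkowski_sym u A : enorm u = 1 -> A !=set0 -> compact A ->
  mean_radius sigma (minkowski_sym u A) = mean_radius sigma A.
Proof.
move=> u1 A0 cA; have [Q QQ uQ] := reflection_mx u1.
have cf := support_continuous A0 cA.
have cfQ : continuous (fun x : 'rV[R]_d => support_fun A (x *m Q)).
  rewrite (_ : (fun x : 'rV[R]_d => _) = support_fun A \o reflection u).
    by move=> x; apply: continuous_comp; [exact: reflection_continuous|exact: cf].
  by apply/funext => y /=; rewrite uQ.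
rewrite /mean_radius.
under eq_Rintegral do rewrite support_minkowski_sym// uQ.
rewrite RintegralZl; [|exact: measurable_sphere|].
  rewrite RintegralD; [|exact: measurable_sphere|exact: continuous_integrable
    |exact: continuous_integrable].
  by rewrite mean_orthogonal//; field.
apply: continuous_integrable => x; exact: cvgD (cf x) (cfQ x).
Qed.

(** The average of the support functions of [A] and of its opposite is
    nonnegative, and both have the same mean. *)
Lemma mean_radius_ge0 A : A !=set0 -> compact A -> 0 <= mean_radius sigma A.
Proof.
move=> A0 cA; have cf := support_continuous A0 cA.
have cN : continuous (fun x : 'rV[R]_d => - x) by move=> x; exact: cvgN cvg_id.
have cfN : continuous (fun x : 'rV[R]_d => support_fun A (- x)).
  by move=> x; apply: continuous_comp; [exact: cN|exact: cf].
have QQ : (- 1%:M : 'M[R]_d) *m (- 1%:M)^T = 1%:M.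
  by rewrite linearN/= trmx1 mulNmx mul1mx opprK.
have E : \int[sigma]_(x in S) support_fun A (- x) = mean_radius sigma A.
  rewrite -[RHS](mean_orthogonal QQ)//; apply: eq_Rintegral => x _.
  by rewrite mulmxN mulmx1.
rewrite -[leRHS](_ : 2^-1 * (mean_radius sigma A + mean_radius sigma A) = _); last by field.
rewrite mulr_ge0// -{2}E -RintegralD; [|exact: measurable_sphere
  |exact: continuous_integrable|exact: continuous_integrable].
apply: Rintegral_ge0 => x _; have [a Aa] := A0.
have := dotv_le_support x cA Aa; have := dotv_le_support (- x) cA Aa.
rewrite dotvNr; lra.
Qed.

Lemma subset_mean_radius A B : A !=set0 -> compact A -> compact B -> A `<=` B ->
  mean_radius sigma A <= mean_radius sigma B.
Proof.
move=> A0 cA cB AB; have B0 : B !=set0 by have [a /AB] := A0; exists a.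
apply: mean_le; [exact: support_continuous|exact: support_continuous|].
by move=> v _; exact: subset_support.
Qed.

Lemma mean_radius_le A r : A !=set0 -> compact A -> A `<=` eball d r ->
  mean_radius sigma A <= r.
Proof.
move=> A0 cA Ar; rewrite -[leRHS]mean_cst; apply: mean_le.
- exact: support_continuous.
- exact: cst_continuous.
- by move=> v v1; rewrite -[r]mulr1 -v1; exact: support_le_eball.
Qed.

Lemma mean_radius_ge A r : A !=set0 -> compact A -> 0 <= r -> eball d r `<=` A ->
  r <= mean_radius sigma A.
Proof.
move=> A0 cA r0 rA; rewrite -[leLHS]mean_cst; apply: mean_le.
- exact: cst_continuous.
- exact: support_continuous.
- by move=> v v1; exact: support_ge_eball.
Qed.

Definition cap v (r : R) : set (borel_rV R d) :=
  S `&` [set x | enorm (x - v) < r].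

Lemma open_enorm_ball v (r : R) : open [set x : 'rV[R]_d | enorm (x - v) < r].
Proof.
have c1 : continuous (fun x : 'rV[R]_d => x - v).
  move=> x; apply: (@continuousB _ _ _ id (cst v)); first exact: cvg_id.
  exact: cst_continuous.
have c : continuous (fun x : 'rV[R]_d => enorm (x - v)).
  by move=> x; exact: continuous_comp (c1 x) (@enorm_continuous R d _).
by move/continuousP : c => /(_ [set y | y < r]); apply; exact: open_lt.
Qed.

Lemma measurable_cap v r : measurable (cap v r).
Proof.
by apply: measurableI; [exact: measurable_sphere|exact: open_borel (@open_enorm_ball v r)].
Qed.

(** Some reflection exchanges [v] and [w]. *)
Lemma sigma_cap_transitive v w r : enorm v = 1 -> enorm w = 1 ->
  sigma (cap v r) = sigma (cap w r).
Proof.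
move=> v1 w1; have [->//|vw] := eqVneq v w.
have n0 : enorm (v - w) != 0.
  by apply: contra vw => /eqP/enorm_eq0/eqP; rewrite subr_eq0.
pose u := (enorm (v - w))^-1 *: (v - w).
have u1 : enorm u = 1.
  by rewrite enormZ ger0_norm ?invr_ge0 ?enorm_ge0// mulVf.
have uv : reflection u v = w.
  have e : 2 * dotv v (v - w) = enorm (v - w) ^+ 2.
    rewrite enorm_sqr dotvBl !dotvBr !dotv_unit// (dotvC w v); ring.
  rewrite /reflection /u dotvZr scalerA.
  rewrite [X in X *: _](_ : _ = 2 * dotv v (v - w) / enorm (v - w) ^+ 2).
    by rewrite e divff ?expf_neq0// scale1r opprB addrC subrK.
  by field.
have [Q QQ uQ] := reflection_mx u1.
rewrite -(haar.2 Q QQ (cap w r) (measurable_cap w r)); congr (sigma _).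
have uB x : enorm (reflection u x - w) = enorm (x - v).
  rewrite -uv -(enorm_reflection u1 (x - v)); congr enorm.
  by rewrite -scaleN1r -(scaleN1r v) reflectionD reflectionZ.
by apply/seteqP; split=> x; rewrite /cap/= -uQ /esphere/= enorm_reflection// uB.
Qed.

(** Finitely many caps of the same measure cover the sphere, whose measure is 1. *)
Lemma sigma_cap_gt0 r : 0 < r -> exists2 c, 0 < c &
  forall v, enorm v = 1 -> fine (sigma (cap v r)) = c.
Proof.
move=> r0; have [[v0 v01]|S0] := pselect (exists v : 'rV[R]_d, enorm v = 1); last first.
  exists 1 => // v v1; exfalso; apply: S0; by exists v.
exists (fine (sigma (cap v0 r))); last first.
  by move=> v v1; rewrite (sigma_cap_transitive r v1 v01).
have cap0 : (sigma (cap v0 r) < +oo)%E.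
  by rewrite (le_lt_trans (probability_le1 _ (measurable_cap v0 r)))// ltry.
apply: fine_gt0; rewrite cap0 andbT lt0e measure_ge0 andbT; apply/eqP => s0.
have := @compact_esphere R d; rewrite compact_cover.
move=> /(_ _ (esphere R d) (fun v => [set x | enorm (x - v) < r])) [].
- by move=> v _; exact: open_enorm_ball.
- by move=> x Sx; exists x => //=; rewrite subrr enorm0.
move=> D DS SD.
have := @content_sub_fsum _ _ _ sigma _ [set` D] S (fun v => cap v r)
  (finite_fset D) (fun v _ => measurable_cap v r) measurable_sphere.
have SD' : S `<=` \bigcup_(v in [set` D]) cap v r.
  by move=> x Sx; have [v Dv xv] := SD x Sx; exists v.
move=> /(_ SD'); rewrite fsbig1.
  move=> S0; have : ((1 : \bar R) <= 0)%E by rewrite -(haar.1); exact: S0.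
  by rewrite leNgt lte01.
move=> v /= Dv; rewrite -s0; apply: sigma_cap_transitive => //.
by have /set_mem := DS v Dv.
Qed.

(** The support function is Lipschitz: if it were less than [l - e] somewhere, it
    would be at most [l - e / 2] on a cap whose measure does not depend on its
    centre. Since it is at most [l + k] elsewhere, its mean would be less than
    [l] for a small [k]. *)
Lemma support_ge_of_mean (M l e : R) : 0 < M -> 0 < e -> exists2 k, 0 < k &
  forall A, A !=set0 -> compact A -> A `<=` eball d M ->
    A `<=` eball d (l + k) -> l <= mean_radius sigma A ->
    forall v, enorm v = 1 -> l - e <= support_fun A v.
Proof.
move=> M0 e0; have r0 : 0 < e / (2 * M) by rewrite divr_gt0// mulr_gt0.
have [c c0 capE] := sigma_cap_gt0 r0.
exists (e * c / 4); first by rewrite divr_gt0// mulr_gt0.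
move=> A A0 cA AM Ak lA v v1; rewrite leNgt; apply/negP => fv.
set k := e * c / 4 in Ak *.
have cf := support_continuous A0 cA.
(* On the cap of radius [e / (2 * M)] around [v], the support function is at
   most [l - e / 2]; elsewhere it is at most [l + k]. *)
pose h (x : borel_rV R d) : R := (l + k) - e / 2 * \1_(cap v (e / (2 * M))) x.
have mC := measurable_cap v (e / (2 * M)).
have i1 : sigma.-integrable S (EFin \o (\1_(cap v (e / (2 * M))) : borel_rV R d -> R)).
  by apply: integrableS (integrable_indic _ mC) => //; exact: measurable_sphere.
have i2 : sigma.-integrable S (EFin \o (cst (l + k) : borel_rV R d -> R)).
  by apply: finite_measure_integrable_cst; exact: measurable_sphere.
have i3 : sigma.-integrable S
    (EFin \o (fun x => e / 2 * \1_(cap v (e / (2 * M))) x) : borel_rV R d -> \bar R).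
  by rewrite (_ : _ \o _ = fun x => ((e / 2)%:E * (\1_(cap v (e / (2 * M))) x)%:E)%E)//;
    apply: integrableZl => //; exact: measurable_sphere.
have ih : sigma.-integrable S (EFin \o h).
  rewrite (_ : EFin \o h = fun x => ((l + k)%:E - (e / 2 * \1_(cap v (e / (2 * M))) x)%:E)%E)//.
  by apply: integrableB => //; exact: measurable_sphere.
have fh : mean_radius sigma A <= \int[sigma]_(x in S) h x.
  apply: le_Rintegral => //; first exact: measurable_sphere.
    exact: continuous_integrable.
  move=> x Sx; rewrite /h indicE; case: (boolP (x \in _)) => [/set_mem[_ /= xv]|_].
    have x1 := support_lipschitz x v A0 cA AM.
    have x2 : M * enorm (x - v) <= e / 2.
      by move: xv; rewrite ltr_pdivlMr ?mulr_gt0//; lra.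
    rewrite mulr1; have : 0 < k by rewrite divr_gt0// mulr_gt0.
    lra.
  rewrite mulr0 subr0; apply: le_trans (support_le_eball x A0 cA Ak) _.
  by rewrite (Sx : enorm x = 1) mulr1.
have hE : \int[sigma]_(x in S) h x = l + k - e / 2 * c.
  rewrite /h RintegralB//; last exact: measurable_sphere.
  rewrite mean_cst RintegralZl//; last exact: measurable_sphere.
  congr (_ - _ * _); rewrite /Rintegral integral_indic//; last exact: measurable_sphere.
  by rewrite setIAC setIid -[RHS](capE v v1).
move: lA; apply/negP; rewrite -ltNge; apply: le_lt_trans fh _; rewrite hE /k.
have : 0 < e * c by rewrite mulr_gt0.
lra.
Qed.

End MeanRadius.

(** * The two symmetrizations along a sequence of directions *)

Lemma subset_transr T (A B C : set T) : B `<=` C -> A `<=` B -> A `<=` C.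
Proof. by move=> BC AB; exact: subset_trans AB BC. Qed.

Section Sequences.
Variables (R : realType) (d : nat) (u : nat -> 'rV[R]_d).
Hypothesis u_sphere : forall n : nat, (1 <= n)%N -> esphere R d (u n).
Hypothesis d_gt0 : (0 < d)%N.
Implicit Types (A K : set 'rV[R]_d) (k m n : nat).

Local Notation Sit := (iter_sym (@steiner R d) u).
Local Notation Mit := (iter_sym (@minkowski_sym R d) u).

Lemma u_unit n : (1 <= n)%N -> enorm (u n) = 1.
Proof. exact: u_sphere. Qed.

Lemma convex_body_iter_steiner k n A : (1 <= k)%N -> convex_body A -> convex_body (Sit k n A).
Proof.
move=> k1 bA; apply: iter_sym_ind => // i B i1; apply: convex_body_steiner.
exact: u_unit.
Qed.

Lemma convex_body_iter_minkowski k n A : (1 <= k)%N -> convex_body A ->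
  convex_body (Mit k n A).
Proof.
move=> k1 bA; apply: iter_sym_ind => // i B i1; apply: convex_body_minkowski_sym.
exact: u_unit.
Qed.

Lemma iter_steiner_sub_iter_minkowski k n A : (1 <= k)%N -> convex_body A ->
  Sit k n A `<=` Mit k n A.
Proof.
move=> k1 bA; elim: n => [|n IHn]; first by rewrite !iter_sym_small.
have [kn|kn] := leqP k n.+1; last by rewrite !iter_sym_small.
rewrite !iter_sym_recr//. apply: (subset_transr (subset_minkowski_sym (u := u n.+1) IHn)).
apply: steiner_sub_minkowski_sym; first exact: u_unit.
exact/convex_body_convex_compact/convex_body_iter_steiner.
Qed.

Lemma iter_minkowski_sub_eball k n A M : (1 <= k)%N -> A `<=` eball d M ->
  Mit k n A `<=` eball d M.
Proof.
move=> k1 AM; apply: (iter_sym_ind (P := fun B => B `<=` eball d M)) => // i B i1.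
by apply: minkowski_sym_sub_eball; exact: u_unit.
Qed.

Lemma volume_iter_steiner k n A : (1 <= k)%N -> convex_body A ->
  volume (Sit k n A) = volume A.
Proof.
move=> k1 bA.
suff [] : convex_body (Sit k n A) /\ volume (Sit k n A) = volume A by [].
apply: (iter_sym_ind (P := fun B => convex_body B /\ volume B = volume A)) => //.
move=> i B i1 [bB <-]; split; first exact: convex_body_steiner (u_unit i1) bB.
exact: volume_steiner (u_unit i1) (convex_body_convex_compact bB).
Qed.

Lemma volume_radius_le A K : convex_body A -> convex_body K ->
  (volume A <= volume K)%E -> volume_radius A <= volume_radius K.
Proof.
move=> bA bK; have [rA <-] := volume_radiusP d_gt0 bA.
by have [rK <-] := volume_radiusP d_gt0 bK; rewrite volume_eball_le.
Qed.

Lemma volume_radius_minkowski_sym v A : enorm v = 1 -> convex_body A ->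
  volume_radius A <= volume_radius (minkowski_sym v A).
Proof.
move=> v1 bA; have cA := convex_body_convex_compact bA.
apply: volume_radius_le => //; first exact: convex_body_minkowski_sym.
by rewrite -(volume_steiner v1 cA); apply: volume_le; exact: steiner_sub_minkowski_sym.
Qed.

(** The extra ball is the image of the ball of radius [r / 2] by the homothety of
    centre [x] and ratio [t = e / (4 * r + 2 * e)]. By convexity it lies in [K],
    and [t] is small enough for its points to have a norm larger than [r]. *)
Lemma extra_ball K (r e h : R) x : convex_compact K -> 0 < r -> 0 < e ->
  r / 2 <= h -> h <= r -> eball d h `<=` K -> K x -> r + e < enorm x ->
  (volume (eball d h) + volume (eball d (e / (4 * r + 2 * e) * (r / 2)))
    <= volume K)%E.
Proof.
move=> [vK _] r0 e0 rh hr hK Kx xre.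
have q0 : 0 < 4 * r + 2 * e by lra.
set t := e / (4 * r + 2 * e).
have t0 : 0 < t by rewrite divr_gt0.
have tq : t * (4 * r + 2 * e) = e by rewrite divfK// gt_eqF.
have rho0 : 0 < t * (r / 2) by rewrite mulr_gt0// divr_gt0.
pose c := (1 - t) *: x.
rewrite [X in (_ + X)%E]volume_eball// -(volume_eball_at c rho0).
have tr : 0 < t * r by rewrite mulr_gt0.
have te : 0 < t * e by rewrite mulr_gt0.
have t1 : t < 1.
  rewrite ltr_pdivrMr// mul1r; lra.
apply: le_trans (volume_superadd _) (volume_le _).
  apply/seteqP; split=> // z [/= zh zc].
  have : enorm c - enorm (z - c) <= enorm z.
    by rewrite (enormC z); have := enormB c (c - z); rewrite subKr.
  have : (1 - t) * (r + e) < enorm c.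
    by rewrite /c enormZ ger0_norm ?subr_ge0 ?ltW// ltr_pM2l// subr_gt0.
  move: zh; rewrite /eball/= => zh; move: zc => /= zc.
  nra.
move=> z [/hK//|/= zc].
have -> : z = (1 - t) *: x + (1 - (1 - t)) *: (t^-1 *: (z - c)).
  by rewrite /c; apply/rowP => i; rewrite !mxE; field; rewrite gt_eqF.
apply: vK => //; [by rewrite subr_ge0 ltW|by rewrite gerBl ltW|].
have ti : 0 <= t^-1 by rewrite invr_ge0 ltW.
apply: hK; apply: subset_eball rh _ _; rewrite /eball/= enormZ ger0_norm//.
by rewrite ler_pdivrMl.
Qed.

(** A point of [F n] far out of the ball of radius [r] would add an extra ball,
    of a fixed positive volume, to the inner balls, whose volumes are eventually
    as close as desired to that of the ball of radius [r]. *)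
Lemma eventually_sub_eball (F : nat -> set 'rV[R]_d) (r : R) : 0 < r ->
  (forall n, convex_compact (F n)) ->
  (forall n, (volume (F n) <= volume (eball d r))%E) ->
  (forall e, 0 < e -> \forall n \near \oo, eball d (r - e) `<=` F n) ->
  forall e, 0 < e -> \forall n \near \oo, F n `<=` eball d (r + e).
Proof.
move=> r0 cF vF inF e e0.
pose rho := e / (4 * r + 2 * e) * (r / 2).
have rho0 : 0 < rho by rewrite mulr_gt0 ?divr_gt0//; lra.
(* Continuity of the power at [r] gives a gap [h] so small that the ball of
   radius [r - h] and the extra ball together are larger than the ball of
   radius [r]. *)
have [h [h0 hr hp]] : exists h, [/\ 0 < h, h <= r / 2 & r ^+ d - rho ^+ d < (r - h) ^+ d].
  have /cvgrPdist_lt/(_ (rho ^+ d) (exprn_gt0 _ rho0)) := @exprn_continuous R d r.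
  move=> /nbhs_ballP[g /= g0 gP].
  pose h := Num.min (g / 2) (r / 2).
  have h0 : 0 < h by rewrite lt_min !divr_gt0.
  exists h; split=> //; first by rewrite ge_min lexx orbT.
  have := gP (r - h); rewrite -ball_normE /ball_/= opprB addrC subrK gtr0_norm//.
  have hg : h < g by rewrite gt_min ltr_pdivrMr// mulr_natr mulr2n ltrDl g0.
  by move=> /(_ hg) /(le_lt_trans (ler_norm _)); lra.
apply: filterS (inF h h0) => n hF x Fx; rewrite /eball/= leNgt; apply/negP => xre.
have hr' : r / 2 <= r - h by lra.
have rh0 : 0 < r - h by lra.
have := extra_ball (cF n) r0 e0 hr' _ hF Fx xre; rewrite gerBl ltW// => /(_ isT).
move=> /le_trans/(_ (vF n)); rewrite -/rho !volume_eball// -EFinD lee_fin -mulrDl.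
rewrite ler_pM2r ?unit_ball_volume_gt0//; lra.
Qed.

Variable sigma : probability (borel_rV R d) R.
Hypothesis haar : is_sphere_haar sigma.

Lemma mean_radius_iter_minkowski k n A : (1 <= k)%N -> convex_body A ->
  mean_radius sigma (Mit k n A) = mean_radius sigma A.
Proof.
move=> k1 bA.
suff [] : convex_body (Mit k n A) /\ mean_radius sigma (Mit k n A) = mean_radius sigma A by [].
apply: (iter_sym_ind (P := fun B => convex_body B /\
  mean_radius sigma B = mean_radius sigma A)) => //.
move=> i B i1 [bB <-]; split; first exact: convex_body_minkowski_sym (u_unit i1) bB.
apply: mean_radius_minkowski_sym; [exact: haar|exact: u_unit|exact: convex_body_nonempty|].
by have [] := convex_body_convex_compact bB.
Qed.

(** The volume radii of the Minkowski iterates increase to some [rho], and the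
    iterates fill all the smaller balls because they contain the Steiner
    iterates of each of them; [eventually_sub_eball] bounds them from outside.
    The value of [rho] follows from the invariance of the mean radius. *)
Lemma S_universal_M_universal : S_universal u -> M_universal sigma u.
Proof.
move=> Su A bA k k1; set F := fun n => Mit k n A.
have bF n : convex_body (F n) by exact: convex_body_iter_minkowski.
have cF n : convex_compact (F n) by exact: convex_body_convex_compact.
have F0 n : F n !=set0 by exact: convex_body_nonempty.
pose r n := volume_radius (F n).
have [M M0 AM] := compact_enorm_bounded (convex_body_convex_compact bA).2.
have rP n : 0 < r n /\ volume (eball d (r n)) = volume (F n) by exact: volume_radiusP.
have rM n : r n <= M.
  rewrite -(volume_eball_le d_gt0) ?(rP n).2 ?(rP n).1//.
  by apply: volume_le; exact: iter_minkowski_sub_eball.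
have rS n : r n <= r n.+1.
  rewrite /r /F; have [kn|kn] := leqP k n.+1.
    by rewrite iter_sym_recr//; apply: volume_radius_minkowski_sym; [exact: u_unit|exact: bF].
  by rewrite !iter_sym_small// ltnW.
have r_mono : {homo r : m n / (m <= n)%N >-> m <= n}.
  by apply: homo_leq => // y x z; exact: le_trans.
pose rho := sup (range r).
have rsup : has_sup (range r) by split; [exists (r 0), 0|exists M => _ [n _ <-]].
have r_rho n : r n <= rho by apply: sup_upper_bound => //; exists n.
have rho0 : 0 < rho by apply: lt_le_trans (r_rho 0); exact: (rP 0).1.
have inF e : 0 < e -> \forall n \near \oo, eball d (rho - e) `<=` F n.
  move=> e0; have e20 : 0 < e / 2 by rewrite divr_gt0.
  have [_ [m0 _ <-] m0e] := sup_adherent e20 rsup.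
  pose m := maxn m0 k.
  have me : rho - e / 2 < r m by apply: lt_le_trans m0e (r_mono _ _ (leq_maxl _ _)).
  have km : (k <= m.+1)%N by rewrite leqW// leq_maxr.
  have cv := Su (F m) (bF m) m.+1 isT.
  have FP n : Sit m.+1 n (F m) !=set0 /\ convex_compact (Sit m.+1 n (F m)).
    have b := convex_body_iter_steiner n (ltn0Sn m) (bF m).
    by split; [exact: convex_body_nonempty|exact: convex_body_convex_compact].
  have h := hausdorff_cvg_ballP (ltW (rP m).1) FP cv e20.
  near=> n; have mn : (m <= n)%N by near: n; exact: nbhs_infty_ge.
  have [_ hn] : Sit m.+1 n (F m) `<=` eball d (r m + e / 2) /\
    eball d (r m - e / 2) `<=` Sit m.+1 n (F m) by near: n; exact: h.
  rewrite /F (iter_sym_cat _ _ _ km mn).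
  apply: (subset_transr (@iter_steiner_sub_iter_minkowski m.+1 n (F m) isT (bF m))).
  apply: (subset_transr hn); apply: subset_eball; lra.
have vF n : (volume (F n) <= volume (eball d rho))%E.
  by rewrite -(rP n).2 volume_eball_le ?(rP n).1.
have outF := eventually_sub_eball rho0 cF vF inF.
have both e : 0 < e -> \forall n \near \oo,
    F n `<=` eball d (rho + e) /\ eball d (rho - e) `<=` F n.
  by move=> e0; near do split; [exact: outF|exact: inF].
suff <- : rho = mean_radius sigma A by apply: hausdorff_cvg_ball => // e e0 _; exact: both.
have near_rho e : 0 < e -> e < rho -> `|rho - mean_radius sigma A| <= e.
  move=> e0 er; have [n [Fn nF]] := filter_ex (both e e0).
  rewrite -(mean_radius_iter_minkowski n k1 bA) ler_distlC; apply/andP; split.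
    by apply: (mean_radius_ge haar (F0 n) (cF n).2 _ nF); rewrite subr_ge0 ltW.
  exact: (mean_radius_le haar (F0 n) (cF n).2 Fn).
apply/eqP; rewrite -subr_eq0 -normr_le0; apply/ler_addgt0Pr => e e0; rewrite add0r.
have m0 : 0 < Num.min e (rho / 2) by rewrite lt_min e0 divr_gt0.
apply: (@le_trans _ _ (Num.min e (rho / 2))); last by rewrite ge_min lexx.
by apply: near_rho => //; rewrite gt_min ltr_pdivrMr// mulr_natr mulr2n ltrDl rho0 orbT.
Unshelve. all: by end_near. Qed.

(** The mean radii of the Steiner iterates decrease to some [lam], and the
    iterates are eventually in all the larger balls because they are contained
    in the Minkowski iterates of each of them; [support_ge_of_mean] bounds them
    from inside. The value of [lam] follows from the invariance of the volume. *)
Lemma M_universal_S_universal : M_universal sigma u -> S_universal u.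
Proof.
move=> Mu A bA k k1; set F := fun n => Sit k n A.
have bF n : convex_body (F n) by exact: convex_body_iter_steiner.
have cF n : convex_compact (F n) by exact: convex_body_convex_compact.
have F0 n : F n !=set0 by exact: convex_body_nonempty.
have [M M0 AM] := compact_enorm_bounded (convex_body_convex_compact bA).2.
have FM n : F n `<=` eball d M.
  apply: (subset_trans (@iter_steiner_sub_iter_minkowski k n A k1 bA)).
  exact: iter_minkowski_sub_eball.
pose l n := mean_radius sigma (F n).
have l0 n : 0 <= l n by apply: mean_radius_ge0 => //; exact: (cF n).2.
have lS n : l n.+1 <= l n.
  rewrite /l /F; have [kn|kn] := leqP k n.+1; last by rewrite !iter_sym_small// ltnW.
  have un := u_unit (isT : (1 <= n.+1)%N).
  have cn : convex_compact (Sit k n A) by exact: cF.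
  rewrite iter_sym_recr// -(mean_radius_minkowski_sym haar un (F0 n) (cF n).2).
  apply: subset_mean_radius => //.
  - by apply: convex_body_nonempty; apply: convex_body_steiner => //; exact: bF.
  - exact: (convex_compact_steiner un cn).2.
  - exact: (convex_compact_minkowski_sym (u n.+1) cn).2.
  - exact: steiner_sub_minkowski_sym.
have l_mono : {homo l : m n / (m <= n)%N >-> n <= m}.
  by apply: (homo_leq (r := fun x y => y <= x)) => // y x z xy yz; exact: le_trans yz xy.
pose lam := inf (range l).
have linf : has_inf (range l) by split; [exists (l 0), 0|exists 0 => _ [n _ <-]].
have lam_l n : lam <= l n by apply: ge_inf; [exact: linf.2|exists n].
have outF e : 0 < e -> \forall n \near \oo, F n `<=` eball d (lam + e).
  move=> e0; have e20 : 0 < e / 2 by rewrite divr_gt0.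
  have [_ [m0 _ <-] m0e] := inf_adherent e20 linf.
  pose m := maxn m0 k.
  have me : l m < lam + e / 2 by apply: le_lt_trans (l_mono _ _ (leq_maxl _ _)) m0e.
  have km : (k <= m.+1)%N by rewrite leqW// leq_maxr.
  have cv := Mu (F m) (bF m) m.+1 isT.
  have FP n : Mit m.+1 n (F m) !=set0 /\ convex_compact (Mit m.+1 n (F m)).
    have b := convex_body_iter_minkowski n (ltn0Sn m) (bF m).
    by split; [exact: convex_body_nonempty|exact: convex_body_convex_compact].
  have h := hausdorff_cvg_ballP (l0 m) FP cv e20.
  near=> n; have mn : (m <= n)%N by near: n; exact: nbhs_infty_ge.
  have [hn _] : Mit m.+1 n (F m) `<=` eball d (l m + e / 2) /\
    eball d (l m - e / 2) `<=` Mit m.+1 n (F m) by near: n; exact: h.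
  rewrite /F (iter_sym_cat _ _ _ km mn).
  apply: (subset_trans (@iter_steiner_sub_iter_minkowski m.+1 n (F m) isT (bF m))).
  apply: (subset_trans hn); apply: subset_eball; lra.
have inF e : 0 < e -> \forall n \near \oo, eball d (lam - e) `<=` F n.
  move=> e0; have [c c0 cP] := support_ge_of_mean haar lam M0 e0.
  apply: filterS (outF c c0) => n Fn.
  apply: (subset_transr (@minkowski_sum_eball0 R d (F n))).
  apply: eball_sub_of_support => // v v1; rewrite subr0.
  apply: cP v1 => //; first exact: (cF n).2.
  by have := lam_l n.
have both e : 0 < e -> \forall n \near \oo,
    F n `<=` eball d (lam + e) /\ eball d (lam - e) `<=` F n.
  by move=> e0; near do split; [exact: outF|exact: inF].
have [rA0 rA] := volume_radiusP d_gt0 bA.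
suff E : lam = volume_radius A.
  by rewrite -E in rA0 *; apply: hausdorff_cvg_ball => // e e0 _; exact: both.
have lam0 : 0 <= lam by apply: lb_le_inf; [exact: linf.1|move=> _ [n _ <-]].
apply/eqP; rewrite -subr_eq0 -normr_le0; apply/ler_addgt0Pr => e e0; rewrite add0r.
have [n [Fn nF]] := filter_ex (both e e0).
have vn : volume (F n) = volume (eball d (volume_radius A)).
  by rewrite rA; exact: volume_iter_steiner.
rewrite ler_distlC; apply/andP; split.
  have [le0|le0] := leP (lam - e) 0; first exact: le_trans le0 (ltW rA0).
  by rewrite -(volume_eball_le d_gt0)// -vn; exact: volume_le.
rewrite -(volume_eball_le d_gt0)//; last by rewrite ltr_wpDl.
by rewrite -vn; exact: volume_le.
Unshelve. all: by end_near. Qed.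

End Sequences.

Theorem theorem1 (R : realType) (d : nat) (d_gt0 : (0 < d)%N)
    (sigma : probability (borel_rV R d) R) (sigma_haar : is_sphere_haar sigma)
    (u : nat -> 'rV[R]_d)
    (u_sphere : forall n : nat, (1 <= n)%N -> esphere R d (u n)) :
  S_universal u <-> M_universal sigma u.
Proof.
split; first exact: S_universal_M_universal.
exact: M_universal_S_universal.
Qed.
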